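(* Let $d\ge 1$, let $X=(X^{(1)},\dots,X^{(d)})$ be uniformly distributed in $[0,1]^d$, and let $Y=m(X)+\epsilon$, where $\epsilon$ is a zero-mean Gaussian noise with finite variance, independent of $X$, and $m:[0,1]^d\to\mathbb{R}$ is a Lipschitz function. Let $(X_1,Y_1),(X_2,Y_2),\dots$ be independent copies of $(X,Y)$. Then there exist depths $k=k_n\in\mathbb{N}$ with $k_n\to\infty$ as $n\to\infty$, and a constant $\tilde C$ (independent of $n$ and $x$), such that for every integer $n>1$ and every $x\in[0,1]^d$, $$\mathbb{E}\big(\tilde m^{Un}_{\infty,n}(x)-m(x)\big)^2\le \tilde C\, n^{-\left(\frac{1}{1+\frac32 d\log 2}\right)}\,(\log n),$$ where $\tilde m^{Un}_{\infty,n}$ is the (translation invariant) infinite uniform KeRF estimator of depth $k=k_n$ built from $(X_1,Y_1),\dots,(X_n,Y_n)$.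
   Context: $\log=\ln$ is the natural logarithm. Lipschitz means that there is $L$ with $|m(x)-m(x')|\le L\sum_{j=1}^d|x_j-x_j'|$ for all $x,x'\in[0,1]^d$. The uniform random forest kernel (based at $0$) with depth parameter $k\in\mathbb{N}$ is, for $x\in[0,1]^d$, $$K^{Un}_k(0,x)=\sum_{k_1+\dots+k_d=k}\frac{k!}{k_1!\cdots k_d!}\Big(\frac1d\Big)^k\prod_{r=1}^d\Big(1-x_r\sum_{j=0}^{k_r-1}\frac{(-\ln x_r)^j}{j!}\Big),$$ the outer sum being over $(k_1,\dots,k_d)$ of nonnegative integers with sum $k$, with the convention $\sum_{j=0}^{-1}=0$, and extended by continuity to points $x$ with some zero coordinates. The (translation invariant) infinite uniform KeRF estimator of depth $k$ built from $(X_1,Y_1),\dots,(X_n,Y_n)$ is $$\tilde m^{Un}_{\infty,n}(x)=\frac{\sum_{i=1}^n Y_i K^{Un}_k(0,|X_i-x|)}{\sum_{i=1}^n K^{Un}_k(0,|X_i-x|)},$$ where $|X_i-x|$ denotes the vector of coordinatewise absolute differences, with the convention $0/0=0$. The expectation is over the data $(X_1,Y_1),\dots,(X_n,Y_n)$. *)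

(* Defs.v *)
From HB Require Import structures.
From mathcomp Require Import all_boot all_order all_algebra finmap.
From mathcomp Require Import all_classical all_reals all_analysis.

Set Implicit Arguments.
Unset Strict Implicit.
Unset Printing Implicit Defensive.

Import Order.TTheory GRing.Theory Num.Theory.
Import numFieldNormedType.Exports.

Local Open Scope classical_set_scope.
Local Open Scope ring_scope.

(* Points of R^d are [d.-tuple R], which the library equips with the product
   sigma-algebra of the Borel sets of R. *)

Section unit_cube.
Context {R : realType} {d : nat}.
Implicit Types x y : d.-tuple R.

Definition unit_cube : set (d.-tuple R) :=
  [set x | forall j, 0 <= tnth x j <= 1].

Definition lipschitz_on_cube (m : d.-tuple R -> R) :=
  exists L : R, forall x x', unit_cube x -> unit_cube x' ->
    `|m x - m x'| <= L * \sum_(j < d) `|tnth x j - tnth x' j|.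

Definition absdiff x y : d.-tuple R := [tuple `|tnth x j - tnth y j| | j < d].

End unit_cube.

Section cube_uniform.
Context {R : realType}.

(* [uniform_prob] lives on [measurableTypeR R], a copy of R whose measurable
   sets are those of R but whose display differs. *)
Definition cons_pair n (p : measurableTypeR R * n.-tuple R) : n.+1.-tuple R :=
  [tuple of (p.1 : R) :: p.2].

Lemma measurable_cons_pair n :
  measurable_fun [set: measurableTypeR R * n.-tuple R] (@cons_pair n).
Proof.
apply: (@measurable_cons _ _ _ R (fun p => p.1 : R)); last exact: measurable_snd.
exact: (@measurable_fst _ _ (measurableTypeR R)).
Qed.

HB.instance Definition _ n :=
  isMeasurableFun.Build _ _ _ _ (@cons_pair n) (@measurable_cons_pair n).

(* The uniform distribution on [0,1]^d, as the d-fold product of the uniform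
   distribution on [0,1]; R^0 is a point. *)
Fixpoint cube_uniform (d : nat) : probability (d.-tuple R) R :=
  match d with
  | 0 => \d_([tuple] : 0.-tuple R)
  | n.+1 => distribution
      (uniform_prob (@ltr01 R) \x cube_uniform n)%E (@cons_pair n)
  end.

Lemma cube_uniform_box d (B : 'I_d -> set R) : (forall j, measurable (B j)) ->
  cube_uniform d [set x | forall j, B j (tnth x j)] =
  (\prod_(j < d) uniform_prob (@ltr01 R) (B j))%E.
Proof.
elim: d B => [|n IH] B mB /=.
  rewrite big_ord0 diracE (_ : _ \in _ = true)//.
  by apply/mem_set => -[].
rewrite big_ord_recl -IH//.
rewrite -product_measure1E//; last first.
  rewrite [X in measurable X](_ : _ = \bigcap_(j in [set: 'I_n])
      ((@tnth n R ^~ j) @^-1` B (lift ord0 j))); last first.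
    by apply/seteqP; split=> x /= h j; [move=> _|]; exact: h.
  apply: fin_bigcap_measurable => // j _.
  by rewrite -[X in measurable X]setTI; exact: measurable_tnth.
  exact: mB.
rewrite /distribution /pushforward; congr ((_ \x _)%E _).
apply/seteqP; split=> -[a x] /=.
  move=> h; split; first by have := h ord0; rewrite (tnth_nth 0).
  by move=> j; have := h (lift ord0 j); rewrite tnthS.
move=> [Ba Bx] j; have [j'|] := unliftP ord0 j.
  by move=> ->; rewrite tnthS; exact: Bx.
by move=> ->; rewrite (tnth_nth 0).
Qed.

End cube_uniform.

(* The centered Gaussian law N(0, s^2), degenerate case included: the library's
   [normal_prob 0 0] is not a point mass but the uniform law on [0,1]. *)
Definition centered_gaussian {R : realType} (s : R) : set R -> \bar R :=
  if s == 0 then \d_(0 : R) else normal_prob 0 s.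

Section random_variables.
Local Open Scope ereal_scope.
Context {disp : measure_display} {T : measurableType disp} {R : realType}
  (P : probability T R).

Definition has_law {d'} {T' : measurableType d'} (X : {RV P >-> T'})
    (mu : set T' -> \bar R) :=
  forall A, measurable A -> distribution P X A = mu A.

Definition identically_distributed {d'} {T' : measurableType d'}
    (X Y : T -> T') :=
  forall A, measurable A -> P (X @^-1` A) = P (Y @^-1` A).

Definition independent_pair {d1 d2} {T1 : measurableType d1}
    {T2 : measurableType d2} (X : {RV P >-> T1}) (Y : {RV P >-> T2}) :=
  forall A B, measurable A -> measurable B ->
    P (X @^-1` A `&` Y @^-1` B) = P (X @^-1` A) * P (Y @^-1` B).

Definition mutually_independent {d'} {T' : measurableType d'}
    (Z : nat -> {RV P >-> T'}) :=
  forall (J : {fset nat}) (B : nat -> set T'), (forall i, measurable (B i)) ->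
    P (\bigcap_(i in [set` J]) (Z i @^-1` B i)) =
    \prod_(i <- J) P (Z i @^-1` B i).

End random_variables.

Section kerf.
Context {R : realType} {d : nat}.

(* At a coordinate t = 0 the product below is 0, which is the limit of
   t * (- ln t) ^+ j / j`! as t tends to 0 from the right: this total definition
   is the extension by continuity. *)
Definition kernel_factor (l : nat) (t : R) : R :=
  1 - t * \sum_(j < l) (- ln t) ^+ j / j`!%:R.

Definition uniform_kernel (k : nat) (z : d.-tuple R) : R :=
  \sum_(ks : {ffun 'I_d -> 'I_k.+1} | (\sum_(r < d) ks r)%N == k)
    k`!%:R / (\prod_(r < d) (ks r)`!%:R) * d%:R^-1 ^+ k *
    \prod_(r < d) kernel_factor (ks r) (tnth z r).

(* Division by zero yields 0, hence 0/0 = 0. *)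
Definition uniform_kerf (k n : nat) (D : nat -> d.-tuple R * R)
    (x : d.-tuple R) : R :=
  (\sum_(i < n) (D i).2 * uniform_kernel k (absdiff (D i).1 x)) /
  (\sum_(i < n) uniform_kernel k (absdiff (D i).1 x)).

End kerf.

(* Main.v *)
Require Import Defs.
From HB Require Import structures.
From mathcomp Require Import all_boot all_order all_algebra finmap.
From mathcomp Require Import all_classical all_reals all_analysis.
From mathcomp Require Import measurable_realfun.
From mathcomp Require Import ring lra.
Import Order.TTheory GRing.Theory Num.Theory.
Import numFieldNormedType.Exports.
Local Open Scope classical_set_scope.
Local Open Scope ring_scope.

(** The error of the estimator at x is A / S, where S is the sum of the weights
    K(0, |X_i - x|) and A is the sum of the residuals Y_i - m x with these
    weights. Everything reduces to means and variances of the two sums.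

    Moments of the kernel. Each factor of the kernel is a Poisson tail
    probability. The fundamental theorem of calculus gives a recursion on its
    order (kernel_momentS), which shows that the integral of t ^ p times the
    factor of order l is of order (p + 2) ^ (- l). Put q = 1 - 1 / (3 d). With
    the multinomial formula, the mean mu of a weight is at least 2 ^ (- k),
    while the mean of |X_r - x_r| times a weight is at most a constant times
    2 ^ (- k) q ^ k (integral_cube_kernel_ge, integral_cube_kernel_dist_le). As
    m is Lipschitz, the mean of A / (n mu) is therefore at most a constant times
    q ^ k <= exp (- k / (3 d)). As the weights are in [0, 1], the variances of
    S / (n mu) and A / (n mu) are at most a constant times
    1 / (n mu) <= 2 ^ k / n.

    Small denominators. When S < n mu / 2, the bound on A says nothing about
    A / S, but A / S is then an average of residuals (or S = 0). The indicator
    of that event is at most 4 (S - n mu) ^ 2 / (n mu) ^ 2, and the largest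
    squared residual is at most t plus a sum of exponentials, of expectation
    O(1 / n) for Gaussian noise as soon as t is a large multiple of ln n. This
    gives one pointwise inequality (weighted_average_error) with three terms
    whose expectations are known, and its integral (kerf_mean_squared_error_le)
    is of order (2 ^ k / n) ln n + exp (- 2 k / (3 d)) + 1 / n. The logarithm
    of the theorem is the level t.

    Depth. The choice k = floor (ln n / (ln 2 + 2 / (3 d))) balances
    2 ^ k / n and exp (- 2 k / (3 d)); both are then of order n ^ (- r) with
    r = (2 / (3 d)) / (ln 2 + 2 / (3 d)) = 1 / (1 + 3 / 2 d ln 2). *)

Set Implicit Arguments.
Unset Strict Implicit.
Unset Printing Implicit Defensive.

(** * The kernel in one coordinate *)

Section one_coordinate.
Context {R : realType}.
Implicit Types (t u x a : R) (l p j : nat).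
Local Notation mu := (@lebesgue_measure R).

Lemma sum_exp_coeff_le t l : 0 <= t -> \sum_(j < l) t ^+ j / j`!%:R <= expR t.
Proof.
move=> t0.
have -> : \sum_(j < l) t ^+ j / j`!%:R = series (exp_coeff t) l.
  by rewrite /series/= big_mkord.
apply: nondecreasing_cvgn_le; last exact: is_cvg_series_exp_coeff.
by apply: nondecreasing_series => n _ _; rewrite exp_coeff_ge0.
Qed.

Lemma kernel_factor_le1 l t : 0 <= t <= 1 -> kernel_factor l t <= 1.
Proof.
move=> /andP[t0 t1]; rewrite /kernel_factor gerBl mulr_ge0// sumr_ge0// => j _.
by rewrite divr_ge0// exprn_ge0// oppr_ge0 ln_le0.
Qed.

(** With lambda = - ln t >= 0, kernel_factor l t is the probability that a
    Poisson variable of mean lambda is at least l. Nonnegativity is the fact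
    that a partial sum of the exponential series at lambda is at most
    exp lambda = 1 / t. *)
Lemma kernel_factor_ge0 l t : 0 <= t <= 1 -> 0 <= kernel_factor l t.
Proof.
move=> /andP[+ t1]; rewrite le_eqVlt => /predU1P[<-|t0].
  by rewrite /kernel_factor mul0r subr0.
have L0 : 0 <= - ln t by rewrite oppr_ge0 ln_le0.
rewrite /kernel_factor subr_ge0.
have := sum_exp_coeff_le l L0; move=> H.
rewrite -(ler_pM2l t0) in H; apply: (le_trans H).
by rewrite expRN lnK ?posrE// divff// gt_eqF.
Qed.

Lemma kernel_factorS l t :
  kernel_factor l.+1 t = kernel_factor l t - t * ((- ln t) ^+ l / l`!%:R).
Proof. by rewrite /kernel_factor big_ord_recr/= mulrDr opprD addrA. Qed.

Lemma kernel_factor_at1 l : kernel_factor l.+1 (1 : R) = 0.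
Proof.
rewrite /kernel_factor ln1 oppr0 mul1r big_ord_recl expr0 fact0 invr1 mulr1.
by rewrite big1 ?addr0 ?subrr// => j _; rewrite expr0n/= mul0r.
Qed.

(** The j-th term of the exponential series at - ln t / 2 is at most
    exp (- ln t / 2) = 1 / sqrt t. This is what makes the kernel continuous at
    a zero coordinate. *)
Lemma log_factor_le_sqrt j t : 0 < t <= 1 ->
  `|t * (- ln t) ^+ j| <= 2 ^+ j * j`!%:R * Num.sqrt t.
Proof.
move=> /andP[t0 t1].
have L0 : 0 <= - ln t / 2 by rewrite divr_ge0// oppr_ge0 ln_le0.
have s0 : 0 < Num.sqrt t by rewrite sqrtr_gt0.
have E : expR (- ln t / 2) = (Num.sqrt t)^-1.
  rewrite -powR12_sqrt ?ltW// /powR gt_eqF// -expRN; congr expR.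
  by rewrite mulrC mulrN.
have := sum_exp_coeff_le j.+1 L0; rewrite big_ord_recr/= => H.
have {}H : (- ln t / 2) ^+ j / j`!%:R <= (Num.sqrt t)^-1.
  rewrite -E; apply: le_trans H; rewrite lerDr sumr_ge0// => i _.
  by rewrite divr_ge0// exprn_ge0.
rewrite ger0_norm; last first.
  by rewrite mulr_ge0 ?(ltW t0)// exprn_ge0// oppr_ge0 ln_le0.
move: H; rewrite ler_pdivrMr ?ltr0n ?fact_gt0// expr_div_n.
rewrite ler_pdivrMr ?exprn_gt0// => H.
rewrite -(ler_pM2l t0) in H; apply: (le_trans H).
rewrite -[X in X * _](sqr_sqrtr (ltW t0)) expr2.
have := gt_eqF s0; move: (Num.sqrt t) => r r0; rewrite le_eqVlt; apply/orP;
  left.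
by apply/eqP; field; rewrite r0.
Qed.

(** Continuity holds on the whole line because ln vanishes on nonpositive
    numbers; having it everywhere spares the one-sided versions below. *)
Lemma continuous_log_factor j : continuous (fun t : R => t * (- ln t) ^+ j).
Proof.
move=> x; have [x0|x0|->] := ltgtP x 0.
- (* to the left of 0 the logarithm is 0 *)
  have E : {near x, (fun t => t * 0 ^+ j) =1 (fun t : R => t * (- ln t) ^+ j)}.
    near=> t; rewrite ln0 ?oppr0//.
    by apply/ltW; near: t; exact: lt_nbhsl.
  rewrite /continuous_at ln0 ?oppr0 ?(ltW x0)//.
  move/near_eq_cvg: E => /cvg_trans; apply.
  by apply: cvgM; [exact: cvg_id|exact: cvg_cst].
- apply: cvgM; first exact: cvg_id.
  apply: (@continuous_comp _ _ _ (fun t : R => - ln t) (fun t : R => t ^+ j)).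
    by apply: (@continuousN _ R^o); exact: continuous_ln.
  exact: exprn_continuous.
- pose g (t : R) := `|t| + 2 ^+ j * j`!%:R * Num.sqrt t.
  have g0 : g t @[t --> (0 : R)] --> (0 : R).
    rewrite [X in _ --> X](_ : _ = g 0);
      last by rewrite /g normr0 sqrtr0 mulr0 addr0.
    apply: cvgD; first exact: (@norm_continuous _ R^o).
    by apply: cvgM; [exact: cvg_cst|exact: sqrt_continuous].
  have fg : \forall t \near (0 : R), - g t <= t * (- ln t) ^+ j <= g t.
    near=> t; rewrite -ler_norml.
    have [t0|t0] := leP t 0.
      rewrite ln0// oppr0 normrM (le_trans (ler_piMr _ _))//.
        by rewrite expr0n; case: (j == 0)%N; rewrite ?normr1 ?normr0.
      by rewrite lerDl mulr_ge0// sqrtr_ge0.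
    apply: le_trans (log_factor_le_sqrt _ _) _; last by rewrite lerDr.
    by rewrite t0/=; apply/ltW; near: t; exact: lt_nbhsl.
  rewrite /continuous_at mul0r; apply: (squeeze_cvgr fg) => //.
  have := @cvgN _ R^o _ _ _ _ _ g0; rewrite oppr0; exact.
Unshelve. all: by end_near. Qed.

Lemma continuous_kernel_factor l : continuous (@kernel_factor R l).
Proof.
elim: l => [|l IH] x.
  rewrite (_ : kernel_factor 0 = cst 1); first exact: cvg_cst.
  by apply/funext => t; rewrite /kernel_factor big_ord0 mulr0 subr0.
rewrite (_ : kernel_factor l.+1 = fun t =>
    kernel_factor l t - (t * (- ln t) ^+ l) * l`!%:R^-1); last first.
  by apply/funext => t; rewrite kernel_factorS mulrA.
apply: (@cvgB _ R^o); first exact: IH.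
by apply: cvgM; [exact: continuous_log_factor|exact: cvg_cst].
Qed.

(** The derivative telescopes to minus the last term of the sum, and t times it
    is kernel_factor l.+1 t - kernel_factor l t. *)
Lemma is_derive_kernel_factor l t : 0 < t ->
  is_derive t 1 (kernel_factor l.+1) (- ((- ln t) ^+ l / l`!%:R)).
Proof.
move=> t0; elim: l => [|l IH].
  rewrite (_ : kernel_factor 1 = fun t => 1 - t :> R); last first.
    apply/funext => u.
    by rewrite kernel_factorS /kernel_factor big_ord0 mulr0 subr0 expr0 fact0
      divr1 mulr1.
  rewrite expr0 fact0 divr1 -[- 1]add0r.
  exact: (@is_deriveB _ R^o R^o).
rewrite (_ : kernel_factor l.+2 = (kernel_factor l.+1 : R^o -> R^o) -
    ((id : R -> R) * (((\- (@ln R)) ^+ l.+1 : R -> R) * cst (l.+1`!%:R^-1))));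
      last first.
  by apply/funext => u; rewrite kernel_factorS !fctE /=.
pose proof (is_derive1_ln t0) as dl.
have dL := is_deriveX l.+1 (is_deriveN dl).
have dM := is_deriveM dL (is_derive_cst (l.+1`!%:R^-1 : R) t (1:R)).
have dI := is_deriveM (is_derive_id t (1:R)) dM.
have dK := is_deriveB IH dI.
apply: is_derive_eq dK _.
rewrite !fctE /GRing.scale/= factS natrM exprS.
have l0 : l.+1%:R != 0 :> R by rewrite pnatr_eq0.
have f0 : l`!%:R != 0 :> R by rewrite pnatr_eq0 -lt0n fact_gt0.
move: (l.+1%:R) (l`!%:R) ((- ln t) ^+ l) (- ln t) l0 f0 => a b c e a0 b0.
by field; rewrite a0 b0 gt_eqF.
Qed.

Definition kernel_moment p l a : R :=
  \int[mu]_(t in `[0, a]) (t ^+ p * kernel_factor l t).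

Lemma continuous_integrable_itv (f : R -> R) a b : continuous f ->
  mu.-integrable `[a, b] (EFin \o f).
Proof.
move=> cf; apply: continuous_compact_integrable; first exact: segment_compact.
exact: continuous_subspaceT.
Qed.

Lemma continuous_moment_integrand p l :
  continuous (fun t : R => t ^+ p * kernel_factor l t).
Proof.
move=> t; apply: cvgM; first exact: exprn_continuous.
exact: continuous_kernel_factor.
Qed.

(** The function t ^+ p.+1 * kernel_factor l.+1 t vanishes at 0 and has
    derivative t ^+ p * (p.+2 * kernel_factor l.+1 t - kernel_factor l t), so
    the fundamental theorem of calculus turns into a recursion on l. It loses
    exactly a factor p + 2 at each step, which is where the bases 2 and 3 of
    the exponential rates come from. *)
Lemma kernel_momentS p l a : 0 <= a ->
  p.+2%:R * kernel_moment p l.+1 a =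
  kernel_moment p l a + a ^+ p.+1 * kernel_factor l.+1 a.
Proof.
rewrite le_eqVlt => /predU1P[<-|a0].
  by rewrite /kernel_moment set_itv1 !Rintegral_set1 exprS !mul0r mulr0 addr0.
pose F (t : R) := t ^+ p.+1 * kernel_factor l.+1 t.
pose f t := p.+2%:R * (t ^+ p * kernel_factor l.+1 t) - t ^+ p * kernel_factor
  l t.
have dF t : 0 < t -> is_derive t 1 F (f t).
  move=> t0; have dX := is_deriveX p.+1 (is_derive_id t (1 : R)).
  have dM := is_deriveM dX (is_derive_kernel_factor l t0).
  rewrite (_ : F = (id : R -> R) ^+ p.+1 * kernel_factor l.+1); last first.
    by apply/funext => u; rewrite /F !fctE.
  apply: is_derive_eq dM _; rewrite !fctE /GRing.scale/= /f kernel_factorS.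
  by rewrite exprS -(natr1 p) -(natr1 p.+1) -(natr1 p); ring.
have cF : continuous F := @continuous_moment_integrand _ _.
have cf : continuous f.
  move=> t; apply: (@cvgB _ R^o); last exact: continuous_moment_integrand.
  by apply: cvgM; [exact: cvg_cst|exact: continuous_moment_integrand].
have : \int[mu]_(t in `[0, a]) f t = F a - F 0.
  rewrite /Rintegral (@continuous_FTC2 _ f F)//.
  - exact: continuous_subspaceT.
  - split.
    + by move=> t /[!in_itv]/= /andP[t0 _]; have [] := dF _ t0.
    + by apply: cvg_at_right_filter; exact: cF.
    + by apply: cvg_at_left_filter; exact: cF.
  - by move=> t /[!in_itv]/= /andP[t0 _]; rewrite derive1E;
    have [_ ->] := dF _ t0.
rewrite {2}/F exprS !mul0r subr0 /f RintegralB//; last 2 first.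
  apply: continuous_integrable_itv => t.
  by apply: cvgM; [exact: cvg_cst|exact: continuous_moment_integrand].
  by apply: continuous_integrable_itv; exact: continuous_moment_integrand.
rewrite RintegralZl//; last first.
  by apply: continuous_integrable_itv; exact: continuous_moment_integrand.
by move=> /(canRL (subrK _)); rewrite addrC.
Qed.

Lemma kernel_moment_ge0 p l a : a <= 1 -> 0 <= kernel_moment p l a.
Proof.
move=> a1; apply: Rintegral_ge0 => t /=; rewrite in_itv/= => /andP[t0 ta].
by rewrite mulr_ge0 ?exprn_ge0// kernel_factor_ge0// t0 (le_trans ta).
Qed.

Lemma Rintegral_itv_cst a (c : R) : 0 <= a -> \int[mu]_(t in `[0, a]) c = c * a.
Proof.
move=> a0; rewrite Rintegral_cst//= lebesgue_measure_itv/= lte_fin.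
by case: ltgtP a0 => //= [_|<-] _; rewrite ?oppr0 ?addr0.
Qed.

(** In the recursion the boundary term is nonnegative. *)
Lemma kernel_moment0_ge l a : 0 <= a <= 1 -> a / 2 ^+ l <= kernel_moment 0 l a.
Proof.
move=> /andP[a0 a1]; elim: l => [|l IH].
  rewrite expr0 divr1 /kernel_moment.
  under eq_Rintegral do rewrite expr0 mul1r /kernel_factor big_ord0 mulr0 subr0.
  by rewrite Rintegral_itv_cst// mul1r.
have := kernel_momentS 0 l a0.
have : 0 <= a ^+ 1 * kernel_factor l.+1 a by rewrite mulr_ge0//
  kernel_factor_ge0// a0.
rewrite [2 ^+ l.+1]exprSr invfM mulrA; lra.
Qed.

(** At a = 1 the boundary term of the recursion vanishes. *)
Lemma kernel_moment1_le p l : kernel_moment p l 1 <= (p.+2%:R ^+ l)^-1.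
Proof.
elim: l => [|l IH].
  rewrite expr0 invr1 -[leRHS](mulr1 1) -Rintegral_itv_cst//.
  apply: le_Rintegral => //.
  - by apply: continuous_integrable_itv; exact: continuous_moment_integrand.
  - by apply: continuous_integrable_itv => t; exact: cvg_cst.
  move=> t /=; rewrite in_itv/= => /andP[t0 t1].
  by rewrite mulr_ile1 ?exprn_ge0 ?exprn_ile1 ?kernel_factor_ge0
    ?kernel_factor_le1 ?t0.
have := kernel_momentS p l (@ler01 R);
  rewrite kernel_factor_at1 mulr0 addr0 => E.
by rewrite exprS invfM -ler_pdivrMl ?invr_gt0 ?ltr0n// invrK E.
Qed.

Lemma continuous_distl (g : R -> R) x : continuous g ->
  continuous (fun u => g `|u - x|).
Proof.
move=> cg u; apply: (@continuous_comp _ _ _ (fun u => `|u - x|) g);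
  last exact: cg.
apply: (@continuous_comp _ _ _ (fun u => u - x) (@Num.norm _ R)).
  by apply: (@cvgB _ R^o); [exact: cvg_id|exact: cvg_cst].
exact: (@norm_continuous _ R^o).
Qed.

Lemma Rintegral_absdiff (g : R -> R) x : continuous g -> 0 <= x <= 1 ->
  \int[mu]_(u in `[0, 1]) g `|u - x| =
  \int[mu]_(t in `[0, x]) g t + \int[mu]_(t in `[0, 1 - x]) g t.
Proof.
move=> cg /andP[x0 x1].
have cgx : continuous (fun u => g `|u - x|) by exact: continuous_distl.
have <- : \int[mu]_(u in `[0, x]) g `|u - x| +
    \int[mu]_(u in `[x, 1]) g `|u - x| = \int[mu]_(u in `[0, 1]) g `|u - x|.
  have := @Rintegral_itvB R (fun u => g `|u - x|) (BLeft 0) (BRight 1) x.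
  rewrite !bnd_simp => /(_ _ x0 x1) E.
  have i01 : mu.-integrable `[0, 1] (EFin \o (fun u => g `|u - x|)).
    exact: continuous_integrable_itv.
  rewrite -[X in _ + X]Rintegral_itv_obnd_cbnd -?(E i01) ?(addrC _ (_ - _))
    ?subrK//.
  by apply: integrableS i01 => //; apply: subset_itv; rewrite bnd_simp.
congr (_ + _).
- pose F (u : R) := x - u.
  have dF u : is_derive u 1 F (- 1 : R).
    rewrite -[- 1]add0r.
    exact: (@is_deriveB _ R^o R^o).
  have F' : (F^`())%classic = cst (- 1 : R).
    by apply/funext => u; rewrite derive1E; have [_ ->] := dF u.
  have cF : continuous F.
    by move=> u; apply: (@cvgB _ R^o); [exact: cvg_cst|exact: cvg_id].
  have -> : (`[0, x] = `[F x, F 0])%classic by rewrite /F subrr subr0.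
  rewrite /Rintegral [in RHS]integration_by_substitution_decreasing//.
  + congr fine; rewrite /F subrr subr0; apply: eq_integral => u.
    rewrite inE/= in_itv/= => /andP[u0 ux].
    by rewrite -/F F' !fctE/= opprK mulr1 distrC ger0_norm// subr_ge0.
  + by move=> u v _ _ uv; rewrite /F ltrD2l ltrN2.
  + by rewrite F' => u _; exact: cvg_cst.
  + by rewrite F'; exact: is_cvg_cst.
  + by rewrite F'; exact: is_cvg_cst.
  + split; first by move=> u _; have [] := dF u.
    by apply: cvg_at_right_filter; exact: cF.
    by apply: cvg_at_left_filter; exact: cF.
  + exact: continuous_subspaceT.
- pose F (u : R) := u - x.
  have dF u : is_derive u 1 F (1 : R).
    rewrite -[1 in X in is_derive _ _ _ X]subr0.
    exact: (@is_deriveB _ R^o R^o).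
  have F' : (F^`())%classic = cst (1 : R).
    by apply/funext => u; rewrite derive1E; have [_ ->] := dF u.
  have cF : continuous F.
    by move=> u; apply: (@cvgB _ R^o); [exact: cvg_id|exact: cvg_cst].
  have -> : (`[0, 1 - x] = `[F x, F 1])%classic by rewrite /F subrr.
  rewrite /Rintegral [in RHS]integration_by_substitution_increasing//.
  + congr fine; apply: eq_integral => u.
    rewrite inE/= in_itv/= => /andP[xu u1].
    by rewrite F' !fctE/= mulr1 ger0_norm// subr_ge0.
  + by move=> u v _ _ uv; rewrite /F ltrD2r.
  + by rewrite F' => u _; exact: cvg_cst.
  + by rewrite F'; exact: is_cvg_cst.
  + by rewrite F'; exact: is_cvg_cst.
  + split; first by move=> u _; have [] := dF u.
    by apply: cvg_at_right_filter; exact: cF.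
    by apply: cvg_at_left_filter; exact: cF.
  + exact: continuous_subspaceT.
Qed.

End one_coordinate.

(** * Integration over the cube and the multinomial formula *)

Section cube.
Context {R : realType}.
Local Notation unif := (uniform_prob (@ltr01 R)).

Lemma measurable_prod_tnth d (g : 'I_d -> R -> R) :
  (forall j, measurable_fun setT (g j)) ->
  measurable_fun [set: d.-tuple R] (fun u => \prod_(j < d) g j (tnth u j)).
Proof.
move=> mg; apply: measurable_prod => j _.
apply: measurableT_comp; first exact: mg.
exact: measurable_tnth.
Qed.

Lemma integral_cube_uniform_prod d (g : 'I_d -> R -> R) :
  (forall j, measurable_fun setT (g j)) -> (forall j t, 0 <= g j t) ->
  (\int[cube_uniform d]_u (\prod_(j < d) g j (tnth u j))%:E =
   \prod_(j < d) \int[unif]_t (g j t)%:E)%E.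
Proof.
elim: d g => [|n IH] g mg g0.
  rewrite big_ord0 /= integral_dirac//=.
    by rewrite diracT big_ord0 mul1e.
  by apply/measurable_EFinP; exact: measurable_prod_tnth.
rewrite /= [RHS]big_ord_recl ge0_integral_pushforward//=; last 2 first.
- by apply/measurable_EFinP; exact: measurable_prod_tnth.
- by move=> u; rewrite lee_fin prodr_ge0.
rewrite (_ : (fun _ => _) = (fun p : measurableTypeR R * n.-tuple R =>
  (g ord0 p.1 * \prod_(j < n) g (lift ord0 j) (tnth p.2 j))%:E)); last first.
  apply/funext => p; rewrite /= big_ord_recl (tnth_nth 0)/=; congr (_ * _)%:E.
  by apply: eq_bigr => j _; rewrite tnthS.
have mh : measurable_fun [set: n.-tuple R]
    (fun u => \prod_(j < n) g (lift ord0 j) (tnth u j)).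
  exact: (@measurable_prod_tnth n (fun j => g (lift ord0 j))).
have h0 u : 0 <= \prod_(j < n) g (lift ord0 j) (tnth u j) by rewrite prodr_ge0.
rewrite fubini_tonelli1//=; last 2 first.
- apply/measurable_EFinP; apply: measurable_funM.
    by apply: (measurableT_comp (mg ord0)); exact: measurable_fst.
  by apply: (measurableT_comp mh); exact: measurable_snd.
- by move=> p; rewrite lee_fin mulr_ge0.
rewrite /fubini_F/= -(IH (fun j => g (lift ord0 j)))//.
under eq_integral => t _.
  under eq_integral do rewrite EFinM.
  rewrite ge0_integralZl//; [over|exact/measurable_EFinP| | ].
  by move=> u _; rewrite lee_fin.
  by rewrite lee_fin.
rewrite ge0_integralZr//.
- by apply/measurable_EFinP; exact: mg.
- by move=> t _; rewrite lee_fin.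
- by apply: integral_ge0 => u _; rewrite lee_fin.
Qed.

End cube.

Section multinomial.
Context {K : realFieldType}.

(** Polynomials that agree with exp (a_r X) up to degree k multiply, up to that
    degree, to exp ((sum of the a_r) X). *)
Lemma coef_prod_exp_poly d (p : 'I_d -> {poly K}) (a : 'I_d -> K) k :
  (forall r j, (j <= k)%N -> (p r)`_j = a r ^+ j / j`!%:R) ->
  forall j, (j <= k)%N ->
    (\prod_(r < d) p r)`_j = (\sum_(r < d) a r) ^+ j / j`!%:R.
Proof.
move=> pE; elim/big_ind2: _ => [[|j] _|q b r c IHb IHc j jk|r _].
- by rewrite coef1 expr0 fact0 divr1.
- by rewrite coef1 expr0n mul0r.
- rewrite coefMr exprDn mulr_suml; apply: eq_bigr => i _.
  have ij : (i <= j)%N by rewrite -ltnS.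
  rewrite IHc ?(leq_trans ij)// IHb; last by rewrite (leq_trans (leq_subr _ _)).
  have f0 n : n`!%:R != 0 :> K by rewrite pnatr_eq0 -lt0n fact_gt0.
  have := bin_fact ij => /(congr1 (GRing.natmul (1 : K))); rewrite !natrM => E.
  rewrite -[_ *+ 'C(_, _)]mulr_natr -E.
  have c0 : 'C(j, i)%:R != 0 :> K by rewrite pnatr_eq0 -lt0n bin_gt0.
  move: (f0 i) (f0 (j - i)%N) c0.
  move: (i`!%:R : K) ((j - i)`!%:R : K) ('C(j, i)%:R : K) => x y z x0 y0 z0.
  by field; rewrite x0 y0 z0.
- exact: pE.
Qed.

(** The multinomial formula, read off the coefficient of degree k in the
    product of the exponentials truncated at k: expanding that product gives a
    sum over the same finite functions as in the kernel. *)
Lemma multinomial_sum d k (a : 'I_d -> K) :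
  \sum_(ks : {ffun 'I_d -> 'I_k.+1} | (\sum_(r < d) ks r)%N == k)
    k`!%:R / (\prod_(r < d) (ks r)`!%:R) * \prod_(r < d) a r ^+ ks r =
  (\sum_(r < d) a r) ^+ k.
Proof.
pose p r : {poly K} := \sum_(j < k.+1) (a r ^+ j / j`!%:R) *: 'X^j.
have k0 : k`!%:R != 0 :> K by rewrite pnatr_eq0 -lt0n fact_gt0.
have pE r j : (j <= k)%N -> (p r)`_j = a r ^+ j / j`!%:R.
  move=> jk; rewrite coef_sum (bigD1 (Ordinal (jk : (j < k.+1)%N)))//= coefZ
    coefXn eqxx mulr1.
  rewrite big1 ?addr0// => i; rewrite -val_eqE/= => ij.
  by rewrite coefZ coefXn eq_sym (negbTE ij) mulr0.
have := coef_prod_exp_poly pE (leqnn k).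
move=> /(canLR (mulfVK k0)) <-.
rewrite bigA_distr_bigA/= coef_sum mulr_suml big_mkcond/=.
apply: eq_bigr => ks _.
rewrite GRing.scaler_prod coefZ -expr_sum coefXn eq_sym.
case: eqP => [_|_]; last by rewrite mulr0 mul0r.
by rewrite mulr1 big_split/= prodfV; ring.
Qed.

End multinomial.

(** * Mean and first moments of the kernel on the cube *)

Section window.
Context {R : realType}.
Implicit Types (t u x a : R) (l p j : nat).
Local Notation mu := (@lebesgue_measure R).
Local Notation unif := (uniform_prob (@ltr01 R)).

(** Cutting the factor off outside [0, 1], where almost surely no data lie,
    keeps it between 0 and 1 on the whole line, even at distances from x larger
    than 1. *)
Definition window x l u : R :=
  \1_(`[0, 1]%classic : set R) u * kernel_factor l `|u - x|.

Lemma windowE x l u : 0 <= u <= 1 -> window x l u = kernel_factor l `|u - x|.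
Proof. by move=> u01; rewrite /window indicE mem_set ?mul1r//= in_itv. Qed.

Lemma window_out x l u : ~~ (0 <= u <= 1) -> window x l u = 0.
Proof. by move=> u01; rewrite /window indicE memNset ?mul0r//= in_itv;
  exact/negP. Qed.

Lemma absdiff_itv x u : 0 <= x <= 1 -> 0 <= u <= 1 -> 0 <= `|u - x| <= 1.
Proof.
move=> /andP[x0 x1] /andP[u0 u1]; rewrite normr_ge0 ler_norml.
by apply/andP; split; lra.
Qed.

Lemma window_ge0_le1 x l u : 0 <= x <= 1 -> 0 <= window x l u <= 1.
Proof.
move=> x01; have [u01|u01] := boolP (0 <= u <= 1).
  rewrite windowE// kernel_factor_ge0 ?kernel_factor_le1//; exact: absdiff_itv.
by rewrite window_out// lexx ler01.
Qed.

Lemma measurable_window x l : measurable_fun setT (window x l).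
Proof.
apply: measurable_funM; first exact: measurable_indic.
apply: continuous_measurable_fun.
by apply: continuous_distl; exact: continuous_kernel_factor.
Qed.

Definition window_moment p l x :=
  kernel_moment p l x + kernel_moment p l (1 - x).

Lemma integral_window p x l : 0 <= x <= 1 ->
  (\int[unif]_u (`|u - x| ^+ p * window x l u)%:E = (window_moment p l x)%:E)%E.
Proof.
move=> x01; pose g t := t ^+ p * kernel_factor l t.
have cg : continuous g := @continuous_moment_integrand _ _ _.
rewrite /window_moment -(Rintegral_absdiff cg x01) /Rintegral fineK; last first.
  apply: integrable_fin_num => //.
  by apply: continuous_integrable_itv; exact: continuous_distl.
rewrite integral_uniform; last 2 first.
- apply/measurable_EFinP; apply: measurable_funM; last exact: measurable_window.
  apply: continuous_measurable_fun.
  by apply: (continuous_distl (g := fun t => t ^+ p)); exact: exprn_continuous.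
- move=> u; rewrite lee_fin mulr_ge0 ?exprn_ge0//.
  by have /andP[] := window_ge0_le1 l u x01.
rewrite subr0 invr1 mul1e; apply: eq_integral => u.
by rewrite inE/= in_itv/= => u01; rewrite windowE.
Qed.

Lemma integral_window0 x l : 0 <= x <= 1 ->
  (\int[unif]_u (window x l u)%:E = (window_moment 0 l x)%:E)%E.
Proof.
move=> x01; rewrite -integral_window//.
by under [RHS]eq_integral do rewrite expr0 mul1r.
Qed.

Lemma kernel_moment_le1 p l a : 0 <= a <= 1 ->
  kernel_moment p l a <= kernel_moment p l 1.
Proof.
move=> /andP[a0 a1].
have i01 : mu.-integrable `[0, 1] (EFin \o (fun t =>
  t ^+ p * kernel_factor l t)).
  apply: continuous_integrable_itv; exact: continuous_moment_integrand.
rewrite -subr_ge0 /kernel_moment Rintegral_itvB// ?bnd_simp//.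
apply: Rintegral_ge0 => t /=; rewrite in_itv/= => /andP[t0 t1].
have {}t0 : 0 <= t by rewrite (le_trans a0)// ltW.
by rewrite mulr_ge0 ?exprn_ge0// kernel_factor_ge0// t0.
Qed.

(** The point x cuts [0, 1] into pieces of lengths x and 1 - x, and the lower
    bound on the moments is linear in the length. *)
Lemma window_moment_ge x l : 0 <= x <= 1 -> 2^-1 ^+ l <= window_moment 0 l x.
Proof.
move=> x01; rewrite /window_moment.
have x01' : 0 <= 1 - x <= 1 by move/andP: x01 => [? ?]; apply/andP; split; lra.
have := lerD (kernel_moment0_ge l x01) (kernel_moment0_ge l x01').
by rewrite -mulrDl addrC subrK mul1r exprVn.
Qed.

Lemma window_moment_le p x l : 0 <= x <= 1 ->
  window_moment p l x <= 2 * p.+2%:R^-1 ^+ l.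
Proof.
move=> x01; rewrite /window_moment exprVn.
have x01' : 0 <= 1 - x <= 1 by move/andP: x01 => [? ?]; apply/andP; split; lra.
have := @kernel_moment1_le R p l.
have := kernel_moment_le1 p l x01; have := kernel_moment_le1 p l x01'.
lra.
Qed.

Lemma window_moment_ge0 p x l : 0 <= x <= 1 -> 0 <= window_moment p l x.
Proof.
by move=> /andP[x0 x1]; rewrite addr_ge0// kernel_moment_ge0//; lra.
Qed.

End window.

Section cube_kernel.
Context {R : realType} {d : nat}.
Implicit Types (x u : d.-tuple R) (k : nat).

Definition multinomial_weight k (ks : {ffun 'I_d -> 'I_k.+1}) : R :=
  k`!%:R / (\prod_(r < d) (ks r)`!%:R) * d%:R^-1 ^+ k.

(** The kernel at |u - x|, cut off outside the cube so that it is between 0 and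
    1 at every u. *)
Definition cube_kernel k x u : R :=
  \sum_(ks : {ffun 'I_d -> 'I_k.+1} | (\sum_(r < d) ks r)%N == k)
    multinomial_weight ks * \prod_(r < d) window (tnth x r) (ks r) (tnth u r).

Lemma multinomial_weight_ge0 k (ks : {ffun 'I_d -> 'I_k.+1}) :
  0 <= multinomial_weight ks.
Proof.
by rewrite mulr_ge0 ?exprn_ge0 ?invr_ge0 ?divr_ge0 ?ler0n// prodr_ge0.
Qed.

Lemma sum_multinomial_weight k (a : 'I_d -> R) :
  \sum_(ks : {ffun 'I_d -> 'I_k.+1} | (\sum_(r < d) ks r)%N == k)
    multinomial_weight ks * \prod_(r < d) a r ^+ ks r =
  ((\sum_(r < d) a r) / d%:R) ^+ k.
Proof.
rewrite expr_div_n -multinomial_sum mulr_suml; apply: eq_bigr => ks _.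
by rewrite /multinomial_weight exprVn mulrAC.
Qed.

Lemma cube_kernelE k x u : unit_cube u ->
  cube_kernel k x u = uniform_kernel k (absdiff u x).
Proof.
move=> u01; apply: eq_bigr => ks _; congr (_ * _); apply: eq_bigr => r _.
by rewrite windowE// /absdiff tnth_mktuple.
Qed.

Lemma measurable_cube_kernel k x : measurable_fun setT (cube_kernel k x).
Proof.
rewrite /cube_kernel; under eq_fun do rewrite -big_filter.
apply: measurable_sum => ks; apply: measurable_funM => //.
apply: (measurable_prod_tnth (g := fun r => window (tnth x r) (ks r))) => r;
  exact: measurable_window.
Qed.

Lemma measurable_uniform_kernel k x :
  measurable_fun setT (fun u : d.-tuple R => uniform_kernel k (absdiff u x)).
Proof.
rewrite /uniform_kernel; under eq_fun do rewrite -big_filter.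
apply: measurable_sum => ks; apply: measurable_funM => //.
under eq_fun do under eq_bigr do rewrite /absdiff tnth_mktuple.
apply: (measurable_prod_tnth (g :=
  fun r t => kernel_factor (ks r) `|t - tnth x r|)) => r.
apply: continuous_measurable_fun.
by apply: continuous_distl; exact: continuous_kernel_factor.
Qed.

Lemma cube_kernel_ge0 k x u : unit_cube x -> 0 <= cube_kernel k x u.
Proof.
move=> x01; apply: sumr_ge0 => ks _; rewrite mulr_ge0 ?multinomial_weight_ge0//.
by apply: prodr_ge0 => r _;
  have /andP[] := window_ge0_le1 (ks r) (tnth u r) (x01 r).
Qed.

(** The multinomial weights sum to 1. *)
Lemma cube_kernel_le1 k x u : (0 < d)%N -> unit_cube x ->
  cube_kernel k x u <= 1.
Proof.
move=> d0 x01; rewrite -[leRHS](expr1n _ k).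
rewrite -[X in _ <= X ^+ _](_ : (\sum_(r < d) (1 : R)) / d%:R = _); last first.
  by rewrite sumr_const card_ord divff// pnatr_eq0 -lt0n.
rewrite -sum_multinomial_weight; apply: ler_sum => ks _.
rewrite ler_wpM2l ?multinomial_weight_ge0//; apply: ler_prod => r _.
by rewrite expr1n window_ge0_le1.
Qed.

Local Notation Q := (@cube_uniform R d).
Local Notation unif := (uniform_prob (@ltr01 R)).

Lemma integral_cube_sum k (F : {ffun 'I_d -> 'I_k.+1} -> 'I_d -> R -> R) :
  (forall ks r, measurable_fun setT (F ks r)) ->
    (forall ks r t, 0 <= F ks r t) ->
  (\int[Q]_u (\sum_(ks : {ffun 'I_d -> 'I_k.+1} | (\sum_(r < d) ks r)%N == k)
     multinomial_weight ks * \prod_(r < d) F ks r (tnth u r))%:E =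
   \sum_(ks : {ffun 'I_d -> 'I_k.+1} | (\sum_(r < d) ks r)%N == k)
     (multinomial_weight ks)%:E * \prod_(r < d) \int[unif]_t (F ks r t)%:E)%E.
Proof.
move=> mF F0.
have mP ks : measurable_fun [set: d.-tuple R] (fun u =>
  \prod_(r < d) F ks r (tnth u r)).
  exact: measurable_prod_tnth.
under eq_integral do rewrite -sumEFin -big_filter.
rewrite -[RHS]big_filter.
rewrite ge0_integral_sum//; last 2 first.
- by move=> ks; apply/measurable_EFinP; exact: measurable_funM.
- by move=> ks u _; rewrite lee_fin mulr_ge0 ?multinomial_weight_ge0 ?prodr_ge0.
apply: eq_bigr => ks _; rewrite -integral_cube_uniform_prod//.
under eq_integral do rewrite EFinM.
rewrite ge0_integralZl//; first exact/measurable_EFinP.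
- by move=> u _; rewrite lee_fin prodr_ge0.
- by rewrite lee_fin multinomial_weight_ge0.
Qed.

(** Each coordinate contributes at least 2 ^- l to the integral of a product of
    factors of orders l, and these orders add up to k. *)
Lemma integral_cube_kernel_ge k x : (0 < d)%N -> unit_cube x ->
  ((2^-1 ^+ k)%:E <= \int[Q]_u (cube_kernel k x u)%:E)%E.
Proof.
move=> d0 x01.
rewrite /cube_kernel (integral_cube_sum (F :=
  fun ks r => window (tnth x r) (ks r))).
2: by move=> ks r; exact: measurable_window.
2: by move=> ks r t; have /andP[] := window_ge0_le1 (ks r) t (x01 r).
under eq_bigr => ks _.
  under eq_bigr => r _ do rewrite integral_window0//.
  rewrite prodEFin -EFinM. over.
rewrite sumEFin lee_fin.
rewrite -[X in X ^+ _](_ : (\sum_(r < d) (2^-1 : R)) / d%:R = _); last first.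
  by rewrite sumr_const card_ord -(mulr_natr 2^-1) mulfK// pnatr_eq0 -lt0n.
rewrite -sum_multinomial_weight; apply: ler_sum => ks _.
rewrite ler_wpM2l ?multinomial_weight_ge0//; apply: ler_prod => r _.
by rewrite exprn_ge0 ?invr_ge0//= window_moment_ge.
Qed.

(** The factor |u - x| in the direction r0 changes the base of that coordinate
    from 1/2 to 1/3, so the multinomial formula gives the power k of
    ((d - 1) / 2 + 1 / 3) / d = (1 - 1 / (3 d)) / 2. *)
Lemma integral_cube_kernel_dist_le k x r0 : unit_cube x ->
  (\int[Q]_u (`|tnth u r0 - tnth x r0| * cube_kernel k x u)%:E <=
    (2 ^+ d * (2^-1 * (1 - (3 * d%:R)^-1)) ^+ k)%:E)%E.
Proof.
move=> x01.
have d0 : d%:R != 0 :> R by rewrite pnatr_eq0; case: (d) r0 => // -[].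
pose F (ks : {ffun 'I_d -> 'I_k.+1}) r t :=
  `|t - tnth x r| ^+ (r == r0) * window (tnth x r) (ks r) t.
under eq_integral => u _.
  rewrite (_ : _ * _ = \sum_(ks : {ffun 'I_d ->
    'I_k.+1} | (\sum_(r < d) ks r)%N == k)
     multinomial_weight ks * \prod_(r < d) F ks r (tnth u r)); last first.
    rewrite mulr_sumr; apply: eq_bigr => ks _.
    rewrite mulrCA; congr (_ * _); rewrite /F [RHS]big_split/=; congr (_ * _).
    rewrite (bigD1 r0)//= eqxx expr1 big1 ?mulr1// => r /negbTE ->.
    by rewrite expr0.
  over.
rewrite (integral_cube_sum (F := F)); last 2 first.
- move=> ks r; apply: measurable_funM; last exact: measurable_window.
  apply: continuous_measurable_fun.
  by apply: (continuous_distl (g := fun t => t ^+ _)); exact: exprn_continuous.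
- move=> ks r t; rewrite mulr_ge0 ?exprn_ge0//.
  by have /andP[] := window_ge0_le1 (ks r) t (x01 r).
under eq_bigr => ks _.
  under eq_bigr => r _ do rewrite integral_window//.
  rewrite prodEFin -EFinM. over.
rewrite sumEFin lee_fin.
pose a (r : 'I_d) : R := (r == r0).+2%:R^-1.
have -> : 2^-1 * (1 - (3 * d%:R)^-1) = (\sum_(r < d) a r) / d%:R.
  rewrite (eq_bigr (fun r => 2^-1 - (r == r0)%:R * 6^-1)); last first.
    by move=> r _; rewrite /a; case: (r == r0) => /=; lra.
  rewrite big_split/= sumr_const card_ord sumrN -mulr_suml.
  rewrite (bigD1 r0)//= eqxx big1 ?addr0; last by move=> r /negbTE ->.
  by rewrite -(mulr_natr 2^-1) /=; field.
rewrite -sum_multinomial_weight mulr_sumr; apply: ler_sum => ks _.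
rewrite mulrCA ler_wpM2l ?multinomial_weight_ge0//.
have -> : 2 ^+ d = \prod_(r < d) (2 : R) by rewrite prodr_const card_ord.
rewrite -[leRHS]big_split/=; apply: ler_prod => r _.
by rewrite window_moment_ge0//= window_moment_le.
Qed.

End cube_kernel.

(** * Independence and equality in law *)

Section laws.
Context {disp : measure_display} {T : measurableType disp} {R : realType}
  (P : probability T R).

Lemma integral_EFin_Rintegral (f : T -> R) :
  P.-integrable setT (fun w => (f w)%:E) ->
  (\int[P]_w (f w)%:E = (\int[P]_w f w)%:E)%E.
Proof. by move=> i; rewrite /Rintegral fineK//; exact: integrable_fin_num. Qed.

Lemma Rintegral_probability_cst (r : R) : \int[P]_w cst r w = r.
Proof. by rewrite Rintegral_cst//= probability_setT mulr1. Qed.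

Lemma identically_distributed_ge0_integral d' (T' : measurableType d')
    (Z Z' : {RV P >-> T'}) (g : T' -> \bar R) :
  identically_distributed P Z Z' -> measurable_fun setT g ->
  (forall z, 0 <= g z)%E ->
  (\int[P]_w g (Z w) = \int[P]_w g (Z' w))%E.
Proof.
move=> ZZ' mg g0.
have := ge0_integral_distribution Z mg g0; rewrite /= => <-.
have := ge0_integral_distribution Z' mg g0; rewrite /= => <-.
by apply: eq_measure_integral => A mA _; exact: ZZ'.
Qed.

Lemma identically_distributed_integrable d' (T' : measurableType d')
    (Z Z' : {RV P >-> T'}) (g : T' -> R) :
  identically_distributed P Z Z' -> measurable_fun setT g ->
  P.-integrable setT (fun w => (g (Z' w))%:E) ->
  P.-integrable setT (fun w => (g (Z w))%:E).
Proof.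
move=> ZZ' mg /integrableP[_ i']; apply/integrableP; split.
  apply/measurable_EFinP; exact: (measurableT_comp mg).
have mg' : measurable_fun setT (fun z => `|(g z)%:E|%E).
  by apply: measurableT_comp => //; exact/measurable_EFinP.
by rewrite (identically_distributed_ge0_integral ZZ' mg').
Qed.

Lemma identically_distributed_Rintegral d' (T' : measurableType d')
    (Z Z' : {RV P >-> T'}) (g : T' -> R) :
  identically_distributed P Z Z' -> measurable_fun setT g ->
  P.-integrable setT (fun w => (g (Z' w))%:E) ->
  \int[P]_w g (Z w) = \int[P]_w g (Z' w).
Proof.
move=> ZZ' mg i'; have i := identically_distributed_integrable ZZ' mg i'.
have mEg : measurable_fun setT (EFin \o g) by exact/measurable_EFinP.
rewrite /Rintegral; congr fine.
rewrite -[LHS](integral_distribution mEg i) -[RHS](integral_distribution mEg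
  i').
by apply: eq_measure_integral => A mA _; exact: ZZ'.
Qed.

Lemma measurable_pair d1 d2 (T1 : measurableType d1) (T2 : measurableType d2)
  (U : {RV P >-> T1}) (V : {RV P >-> T2}) :
  measurable_fun setT (fun w => (U w, V w)).
Proof. exact: measurable_fun_pair. Qed.

Definition pair_rv d1 d2 (T1 : measurableType d1) (T2 : measurableType d2)
    (U : {RV P >-> T1}) (V : {RV P >-> T2}) : {RV P >-> (T1 * T2)%type} :=
  HB.pack (fun w => (U w, V w))
    (isMeasurableFun.Build _ _ _ _ _ (measurable_pair U V)).

(** Independence says that the joint law is the product of the laws, so that
    Fubini's theorem factors the expectation. *)
Lemma independent_RintegralM d1 d2 (T1 : measurableType d1)
    (T2 : measurableType d2) (U : {RV P >-> T1}) (V : {RV P >-> T2})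
    (f : T1 -> R) (g : T2 -> R) :
  independent_pair U V -> measurable_fun setT f -> measurable_fun setT g ->
  P.-integrable setT (fun w => (f (U w))%:E) ->
  P.-integrable setT (fun w => (g (V w))%:E) ->
  P.-integrable setT (fun w => (f (U w) * g (V w))%:E) ->
  \int[P]_w (f (U w) * g (V w)) = (\int[P]_w f (U w)) * \int[P]_w g (V w).
Proof.
move=> UV mf mg ifU igV ifg.
pose h (z : T1 * T2) := (f z.1 * g z.2)%:E.
have mh : measurable_fun setT h.
  apply/measurable_EFinP; apply: measurable_funM.
    by apply: (measurableT_comp mf); exact: measurable_fst.
  by apply: (measurableT_comp mg); exact: measurable_snd.
have mEf : measurable_fun setT (EFin \o f) by exact/measurable_EFinP.
have mEg : measurable_fun setT (EFin \o g) by exact/measurable_EFinP.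
pose mU := distribution P U; pose mV := distribution P V.
have E A : measurable A -> (mU \x mV)%E A = distribution P (pair_rv U V) A.
  by move=> mA; apply: product_measure_unique => // B C mB mC; exact: UV.
have ihW : (distribution P (pair_rv U V)).-integrable setT h.
  exact: integrable_pushforward.
have ih : (mU \x mV)%E.-integrable setT h.
  move/integrableP : ihW => [_ ihW]; apply/integrableP; split=> //.
  apply: le_lt_trans ihW; rewrite le_eqVlt; apply/orP; left; apply/eqP.
  by apply: eq_measure_integral => A mA _; exact: E.
have iV : mV.-integrable setT (EFin \o g) by exact: integrable_pushforward.
have iU : mU.-integrable setT (EFin \o f) by exact: integrable_pushforward.
have EV := integral_distribution mEg igV.
have EU := integral_distribution mEf ifU.
have Efg : (\int[P]_w (f (U w) * g (V w))%:E =
    \int[P]_w (f (U w))%:E * \int[P]_w (g (V w))%:E)%E.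
  have := @integral_distribution _ _ _ _ _ P (pair_rv U V) h mh ifg;
    rewrite /= => <-.
  rewrite -[X in (X * _)%E]EU -[X in (_ * X)%E]EV.
  transitivity (\int[(mU \x mV)%E]_z h z)%E.
    by apply: eq_measure_integral => A mA _; exact/esym/E.
  rewrite -integral12_prod_meas1// /fubini_F /h/=.
  under eq_integral => u _.
    under eq_integral do rewrite EFinM.
    rewrite integralZl//. over.
  rewrite -(@fineK _ (\int[mV]_x (g x)%:E)%E); last exact: integrable_fin_num.
  by rewrite integralZr.
rewrite /Rintegral Efg fineM//; exact: integrable_fin_num.
Qed.

Lemma mutually_independent_pair d' (T' : measurableType d')
    (Z : nat -> {RV P >-> T'}) i j :
  mutually_independent Z -> i != j -> independent_pair (Z i) (Z j).
Proof.
move=> indZ ij A B mA mB.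
pose BB l := if l == i then A else B.
have := indZ [fset i; j]%fset BB.
rewrite big_fsetU1/=; last by rewrite inE.
rewrite big_seq_fset1 /BB eqxx eq_sym (negbTE ij).
move=> <-; last by move=> l; case: ifP.
congr (P _); apply/seteqP; split => w /=.
  by move=> [Aw Bw] l /=; rewrite !inE => /orP[] /eqP ->;
    rewrite ?eqxx// eq_sym (negbTE ij).
move=> h; split.
  by have /= := h i; rewrite eqxx !inE eqxx; apply.
by have /= := h j; rewrite eq_sym (negbTE ij) !inE eqxx orbT; apply.
Qed.

Lemma integrable_sqr_prod (f g : T -> R) : measurable_fun setT f ->
  measurable_fun setT g ->
  P.-integrable setT (fun w => (f w ^+ 2)%:E) ->
  P.-integrable setT (fun w => (g w ^+ 2)%:E) ->
  P.-integrable setT (fun w => (f w * g w)%:E).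
Proof.
move=> mf mg if2 ig2.
apply: (le_integrable _ _ _ (integrableD _ if2 ig2)) => //.
  by apply/measurable_EFinP; exact: measurable_funM.
move=> w _; rewrite /= lee_fin normrM [leRHS]ger0_norm ?addr_ge0 ?sqr_ge0//.
rewrite -(real_normK (num_real (f w))) -(real_normK (num_real (g w))).
have := sqr_ge0 (`|f w| - `|g w|); have := normr_ge0 (f w);
  have := normr_ge0 (g w).
nra.
Qed.

Lemma integrable_of_sqr (f : T -> R) : measurable_fun setT f ->
  P.-integrable setT (fun w => (f w ^+ 2)%:E) ->
  P.-integrable setT (fun w => (f w)%:E).
Proof.
move=> mf if2.
have -> : (fun w => (f w)%:E) = (fun w => (f w * cst 1 w)%:E).
  by apply/funext => w; rewrite /= mulr1.
apply: integrable_sqr_prod => //=.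
by under eq_fun do rewrite expr1n; exact: finite_measure_integrable_cst.
Qed.

(** Off the diagonal, pairwise independence factors the expectations of the
    products of terms of the sum. *)
Lemma second_moment_sum d' (T' : measurableType d') (Z : nat -> {RV P >-> T'})
    (Z' : {RV P >-> T'}) (f : T' -> R) n :
  mutually_independent Z ->
  (forall i, identically_distributed P (Z i) Z') -> measurable_fun setT f ->
  P.-integrable setT (fun w => (f (Z' w) ^+ 2)%:E) ->
  (\int[P]_w ((\sum_(i < n) f (Z i w)) ^+ 2)%:E <=
    (n%:R * (\int[P]_w (f (Z' w) ^+ 2)) +
     (n%:R * \int[P]_w f (Z' w)) ^+ 2)%:E)%E.
Proof.
move=> indZ ZZ' mf if2.
set a := \int[P]_w (f (Z' w) ^+ 2); set b := \int[P]_w f (Z' w).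
have mfZ i : measurable_fun setT (fun w =>
  f (Z i w)) by exact: (measurableT_comp mf).
have mfZ' : measurable_fun setT (fun w =>
  f (Z' w)) by exact: (measurableT_comp mf).
have mf2 : measurable_fun setT (fun z => f z ^+ 2) by exact: measurable_funX.
have i1 : P.-integrable setT (fun w => (f (Z' w))%:E).
  exact: integrable_of_sqr.
have i2 i : P.-integrable setT (fun w => (f (Z i w) ^+ 2)%:E).
  exact: (identically_distributed_integrable (ZZ' i) mf2 if2).
have iM i j : P.-integrable setT (fun w => (f (Z i w) * f (Z j w))%:E).
  exact: integrable_sqr_prod.
have EM (i j : 'I_n) : \int[P]_w (f (Z i w) * f (Z j w)) <= (i == j)%:R * a + b
  ^+ 2.
  have [<-|ij] := eqVneq i j.
    under eq_Rintegral do rewrite -expr2.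
    rewrite (identically_distributed_Rintegral (ZZ' i) mf2 if2) mul1r lerDl.
    exact: sqr_ge0.
  rewrite mul0r add0r independent_RintegralM//.
  - by rewrite !(identically_distributed_Rintegral (ZZ' _) mf i1) expr2.
  - by apply: mutually_independent_pair => //; rewrite (inj_eq val_inj).
  - exact: (identically_distributed_integrable (ZZ' i) mf i1).
  - exact: (identically_distributed_integrable (ZZ' j) mf i1).
under eq_integral.
  move=> w _; rewrite expr2 mulr_suml.
  under eq_bigr do rewrite mulr_sumr.
  rewrite -sumEFin.
  under eq_bigr do rewrite -sumEFin.
  over.
rewrite integral_sum//; last first.
  by move=> i; apply: integrable_sum => // j _; exact: iM.
under eq_bigr => i _.
  rewrite integral_sum//.
  under eq_bigr => j _.
    rewrite integral_EFin_Rintegral; last exact: iM. over.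
  rewrite sumEFin. over.
rewrite sumEFin lee_fin.
apply: (@le_trans _ _ (\sum_(i < n) \sum_(j < n) ((i == j)%:R * a + b ^+ 2))).
  by apply: ler_sum => i _; apply: ler_sum => j _; exact: EM.
under eq_bigr => i _.
  rewrite big_split/= sumr_const card_ord (bigD1 i)//= eqxx mul1r big1 ?addr0;
    last first.
    by move=> j /negbTE; rewrite eq_sym => ->; rewrite mul0r.
  over.
rewrite big_split/= !sumr_const !card_ord exprMn -(mulr_natl a).
by rewrite -(mulr_natl (b ^+ 2)) -(mulr_natl (n%:R * b ^+ 2)) mulrA expr2.
Qed.

End laws.

(** * Gaussian noise *)

Section gaussian.
Context {R : realType}.
Local Notation mu := (@lebesgue_measure R).

(** The normal law is defined by integrating its density over sets, so that this
    density is its Radon-Nikodym derivative almost everywhere. *)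
Lemma ge0_integral_normal_prob s (f : R -> \bar R) :
  measurable_fun setT f -> (forall x, 0 <= f x)%E ->
  (\int[normal_prob 0 s]_x f x = \int[mu]_x (f x * (normal_pdf 0 s x)%:E))%E.
Proof.
move=> mf f0; pose nu : {finite_measure set _ -> \bar R} := normal_prob 0 s.
have dom : nu `<< mu := normal_prob_dominates 0 s.
rewrite -(Radon_Nikodym_SigmaFinite.change_of_variables dom f0)//.
have mpdf : measurable_fun setT (fun x : R => (normal_pdf 0 s x)%:E).
  by apply/measurable_EFinP; exact: measurable_normal_pdf.
have iRN := Radon_Nikodym_SigmaFinite.f_integrable dom.
have mRN := measurable_int _ iRN.
apply: ge0_ae_eq_integral => //.
- exact: emeasurable_funM.
- exact: emeasurable_funM.
- by move=> x _; rewrite mule_ge0// Radon_Nikodym_SigmaFinite.f_ge0.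
- by move=> x _; rewrite mule_ge0// lee_fin normal_pdf_ge0.
have := integral_ae_eq measurableT iRN mpdf.
move=> /(_ _)/filterS; apply; last first.
  by move=> E _ mE; rewrite -Radon_Nikodym_SigmaFinite.f_integral.
by move=> x /= E _; rewrite E.
Qed.

(** Multiplying the density of variance s ^ 2 by exp (x ^ 2 / (4 s ^ 2)) yields
    a multiple of the density of variance 2 s ^ 2. *)
Lemma normal_exp_sqr_lty s : s != 0 ->
  (\int[normal_prob 0 s]_x (expR ((4 * s ^+ 2)^-1 * (x : R) ^+ 2))%:E < +oo)%E.
Proof.
move=> s0; rewrite ge0_integral_normal_prob; last 2 first.
- apply/measurable_EFinP; apply: measurableT_comp => //.
  by apply: measurable_funM => //; exact: measurable_funX.
- by move=> x; rewrite lee_fin expR_ge0.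
pose s' := Num.sqrt 2 * s.
have s2 : Num.sqrt 2 != 0 :> R by rewrite gt_eqF// sqrtr_gt0.
have s'0 : s' != 0 by rewrite mulf_neq0.
pose C := normal_peak s / normal_peak s'.
rewrite (_ : (fun x => _) = (fun x => C%:E * (normal_pdf 0 s' x)%:E)%E).
  rewrite integralZl//; last exact: integrable_normal_pdf.
  by rewrite integral_normal_pdf mule1 ltry.
apply/funext => x; rewrite -!EFinM !normal_pdfE// /C; congr EFin.
rewrite -mulrA mulKf ?gt_eqF ?normal_peak_gt0// mulrCA; congr (_ * _).
rewrite /normal_fun -expRD; congr expR; rewrite /s' exprMn sqr_sqrtr// subr0.
by field.
Qed.

Lemma normal_prob_sym s (A : set R) : s != 0 -> measurable A ->
  normal_prob 0 s (-%R @^-1` A) = normal_prob 0 s A.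
Proof.
move=> s0 mA; rewrite /normal_prob.
have mpdf : measurable_fun A (fun x : R => (normal_pdf 0 s x)%:E).
  apply: measurable_funTS; apply/measurable_EFinP; exact: measurable_normal_pdf.
transitivity (\int[pushforward mu (-%R : _ -> measurableTypeR R)]_(x in A)
    (normal_pdf 0 s x)%:E)%E; last first.
  by apply: eq_measure_integral => B mB _; exact: lebesgue_measureN.
rewrite ge0_integral_pushforward//.
  apply: eq_integral => x _; rewrite /= /normal_pdf; rewrite (negbTE s0).
  by rewrite /normal_fun !subr0 sqrrN.
by move=> x _; rewrite lee_fin normal_pdf_ge0.
Qed.

End gaussian.

Section gaussian_rv.
Context {disp : measure_display} {T : measurableType disp} {R : realType}
  (P : probability T R) (eps : {RV P >-> R}) (s : R).
Hypothesis eps_law : has_law eps (centered_gaussian s).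

Lemma gaussian_exp_sqr_integrable : exists2 c : R, 0 < c &
  P.-integrable setT (fun w => (expR (c * eps w ^+ 2))%:E).
Proof.
have me c : measurable_fun setT (fun x : R => (expR (c * x ^+ 2))%:E).
  apply/measurable_EFinP; apply: measurableT_comp => //.
  by apply: measurable_funM => //; exact: measurable_funX.
have e0 c (x : R) : (0 <= (expR (c * x ^+ 2))%:E)%E by rewrite lee_fin expR_ge0.
suff [c c0 H] : exists2 c : R, 0 < c &
    (\int[distribution P eps]_x (expR (c * (x : R) ^+ 2))%:E < +oo)%E.
  exists c => //; apply/integrableP; split.
    by apply: (measurableT_comp (me c)).
  under eq_integral do rewrite gee0_abs//.
  by rewrite ge0_integral_distribution in H.
have [s0|s0] := eqVneq s 0.
  exists 1 => //; rewrite (eq_measure_integral (\d_ (0 : R))).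
    rewrite integral_dirac//= diracT mul1e ltry//.
  by move=> A mA _; apply: (etrans (eps_law mA));
    rewrite /centered_gaussian s0 eqxx.
exists (4 * s ^+ 2)^-1; first by rewrite invr_gt0 mulr_gt0// exprn_even_gt0.
(* the normal law lives on a copy of R with another display *)
pose i : measurableTypeR R -> R := id.
have mi : measurable_fun setT i by exact: measurable_id.
rewrite (eq_measure_integral (pushforward (normal_prob 0 s) i)).
  rewrite ge0_integral_pushforward//; first exact: normal_exp_sqr_lty.
by move=> A mA _; apply: (etrans (eps_law mA));
  rewrite /centered_gaussian (negbTE s0).
Qed.

Lemma gaussian_sqr_integrable : P.-integrable setT (fun w => (eps w ^+ 2)%:E).
Proof.
have [c c0 ie] := gaussian_exp_sqr_integrable.
apply: (le_integrable _ _ _ (integrableZl _ (c^-1) ie)) => //.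
  by apply/measurable_EFinP; exact: measurable_funX.
move=> w _; rewrite /= lee_fin !ger0_norm ?sqr_ge0 ?mulr_ge0 ?expR_ge0
  ?invr_ge0 ?(ltW c0)//.
rewrite mulrC ler_pdivlMr// mulrC (le_trans _ (expR_ge1Dx _))//.
by rewrite lerDr.
Qed.

(** The noise and its opposite have the same law. *)
Lemma gaussian_mean0 : \int[P]_w eps w = 0.
Proof.
have ie : P.-integrable setT (fun w => (eps w)%:E).
  by apply: integrable_of_sqr => //; exact: gaussian_sqr_integrable.
have mN : measurable_fun setT (fun w => - eps w) by exact: measurable_funN.
pose Neps : {RV P >-> R} :=
  HB.pack (fun w => - eps w) (isMeasurableFun.Build _ _ _ _ _ mN).
have idN : identically_distributed P Neps eps.
  move=> A mA; rewrite (_ : Neps @^-1` A = eps @^-1` (-%R @^-1` A))//.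
  have mNA : measurable (-%R @^-1` A).
    by rewrite -[X in measurable X]setTI;
      apply: (measurable_funN (@measurable_id _ _ _)).
  have := eps_law mNA; rewrite /distribution /pushforward => ->.
  have := eps_law mA; rewrite /distribution /pushforward => ->.
  rewrite /centered_gaussian; case: eqP => [_|/eqP s0];
    last exact: normal_prob_sym.
  rewrite /dirac/= !indicE; congr ((_ : bool)%:R%:E).
  by apply/idP/idP => /set_mem; rewrite /= ?oppr0 => A0; apply/mem_set;
    rewrite /= ?oppr0.
have := identically_distributed_Rintegral (g :=
  id) idN (@measurable_id _ _ _) ie.
rewrite /= => E.
have E2 : \int[P]_w (- eps w) = - \int[P]_w eps w.
  rewrite -mulN1r -RintegralZl//.
  by apply: eq_Rintegral => w _; rewrite mulN1r.
by move: E; rewrite E2; lra.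
Qed.
End gaussian_rv.

(** * Pointwise control of a weighted average *)

Section pointwise.
Context {R : realType}.

(** From z <= exp z. A maximum of n squares is thus bounded by a level t plus a
    sum of exponentials, each negligible in expectation once t is of order
    ln n. *)
Lemma le_add_expR (c t z : R) : 0 < c -> z <= t + c^-1 * expR (c * (z - t)).
Proof.
move=> c0; rewrite -lerBlDl -ler_pdivrMl ?invr_gt0// invrK.
by rewrite (le_trans _ (expR_ge1Dx _))// lerDr.
Qed.

(** The error of the average is the quotient of the weighted sum of the
    residuals y i - v by the total weight S. If S >= N / 2 it is bounded by the
    first term. Otherwise (S - N) ^ 2 >= N ^ 2 / 4, so the coefficient of M + t
    in the second term is at least 1; and the error is either |v|, when S = 0,
    or an average of the residuals, at most the largest one in absolute value.
    For N the expectation of S, both squares on the right have expectations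
    given by variances and means of single terms. *)
Lemma weighted_average_error n (y w : 'I_n -> R) v N M t c :
  (forall i, 0 <= w i) -> 0 < N -> 0 < c -> 0 <= t -> v ^+ 2 <= M ->
  ((\sum_(i < n) y i * w i) / (\sum_(i < n) w i) - v) ^+ 2 <=
  4 / N ^+ 2 * (\sum_(i < n) (y i - v) * w i) ^+ 2 +
  4 * (M + t) / N ^+ 2 * (\sum_(i < n) w i - N) ^+ 2 +
  c^-1 * \sum_(i < n) expR (c * ((y i - v) ^+ 2 - t)).
Proof.
move=> w0 N0 c0 t0 vM.
set S := \sum_(i < n) w i; set A := \sum_(i < n) (y i - v) * w i.
set E := c^-1 * _.
have E0 : 0 <= E by rewrite mulr_ge0 ?invr_ge0 ?(ltW c0)// sumr_ge0// => i _;
  exact: expR_ge0.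
have M0 : 0 <= M by rewrite (le_trans _ vM)// sqr_ge0.
have S0 : 0 <= S by exact: sumr_ge0.
have AE : A = \sum_(i < n) y i * w i - v * S.
  by rewrite mulr_sumr -sumrB; apply: eq_bigr => i _; rewrite mulrBl.
have N20 : 0 < N ^+ 2 by rewrite exprn_gt0.
have B0 : 0 <= 4 * (M + t) / N ^+ 2 * (S - N) ^+ 2.
  by rewrite mulr_ge0 ?sqr_ge0// divr_ge0 ?(ltW N20)// mulr_ge0// addr_ge0.
have A0 : 0 <= 4 / N ^+ 2 * A ^+ 2.
  by rewrite mulr_ge0 ?sqr_ge0// divr_ge0 ?(ltW N20).
have quo : S != 0 -> (\sum_(i < n) y i * w i) / S - v = A / S.
  by move=> Sn0; rewrite AE mulrBl mulfK.
have [SN|SN] := leP (N / 2) S.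
  have Sp : 0 < S by rewrite (lt_le_trans _ SN)// divr_gt0.
  rewrite quo ?gt_eqF//.
  apply: (@le_trans _ _ (4 / N ^+ 2 * A ^+ 2)); last first.
    by rewrite -addrA lerDl addr_ge0.
  rewrite expr_div_n mulrC ler_wpM2r ?sqr_ge0//.
  rewrite -[leRHS]invrK lef_pV2 ?posrE ?exprn_gt0 ?invr_gt0 ?divr_gt0//.
  rewrite invf_div ler_pdivrMr//; nra.
have far : 1 <= 4 / N ^+ 2 * (S - N) ^+ 2.
  rewrite mulrAC ler_pdivlMr// mul1r; nra.
have Mt : M + t <= 4 * (M + t) / N ^+ 2 * (S - N) ^+ 2.
  rewrite (_ : 4 * (M + t) / _ * _ = (M + t) * (4 / N ^+ 2 * (S - N) ^+ 2)).
    by rewrite ler_peMr// addr_ge0.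
  by ring.
apply: (@le_trans _ _ (M + t + E)); last first.
  by rewrite lerD// (le_trans Mt)// lerDr.
have [S00|Sn0] := eqVneq S 0.
  rewrite S00 invr0 mulr0 sub0r sqrrN (le_trans vM)// -addrA lerDl addr_ge0//.
have Sp : 0 < S by rewrite lt_neqAle eq_sym Sn0.
rewrite quo// (@le_trans _ _ (t + E)) ?lerD2r ?lerDr//.
have tE0 : 0 <= t + E by rewrite addr_ge0.
have yle i : `|y i - v| <= Num.sqrt (t + E).
  rewrite -sqrtr_sqr ler_wsqrtr// (le_trans (le_add_expR t _ c0))// lerD2l.
  rewrite ler_wpM2l ?invr_ge0 ?(ltW c0)// (bigD1 i)//= lerDl sumr_ge0// => j _;
    exact: expR_ge0.
have AS : `|A / S| <= Num.sqrt (t + E).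
  rewrite normrM (ger0_norm (_ : 0 <= S^-1)) ?invr_ge0// ler_pdivrMr//.
  rewrite (le_trans (ler_norm_sum _ _ _))// mulr_sumr ler_sum// => i _.
  by rewrite normrM (ger0_norm (w0 i)) ler_wpM2r.
rewrite -(real_normK (num_real (A / S))) -[leRHS]sqr_sqrtr//.
by rewrite ler_sqr ?nnegrE ?normr_ge0 ?sqrtr_ge0.
Qed.

End pointwise.

(** Inversion is discontinuous at 0, but it is x times a power of x ^ 2. *)
Lemma measurable_invr (R : realType) : measurable_fun setT (fun x : R => x^-1).
Proof.
have -> : (fun x : R => x^-1) = (fun x => x * (x ^+ 2) `^ (- 1)).
  apply/funext => x; rewrite powR_inv1 ?sqr_ge0//.
  have [->|x0] := eqVneq x 0; first by rewrite invr0 mul0r.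
  by rewrite expr2 invfM mulrA divff// mul1r.
apply: measurable_funM => //.
apply: (@measurableT_comp _ _ _ _ _ _ (fun x : R => x `^ (- 1))).
  exact: measurable_powR.
exact: measurable_funX.
Qed.

(** * The uniform law on the cube and Lipschitz functions *)

Section cube_facts.
Context {R : realType} {d : nat}.
Implicit Types (x u : d.-tuple R).

Lemma measurable_unit_cube : measurable (@unit_cube R d).
Proof.
rewrite (_ : unit_cube = \bigcap_(j in [set: 'I_d])
    ((fun x : d.-tuple R => tnth x j) @^-1` `[0, 1]%classic)); last first.
  by apply/seteqP; split=> x /= h j; [move=> _|]; have := h j;
    rewrite /= in_itv//=; apply.
apply: fin_bigcap_measurable => // j _.
by rewrite -[X in measurable X]setTI; exact: measurable_tnth.
Qed.

Lemma cube_uniform_unit_cube : cube_uniform d (@unit_cube R d) = 1%E.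
Proof.
have := @cube_uniform_box R d (fun=> `[0, 1]%classic) (fun=> measurable_itv _).
rewrite (_ : [set x | _] = unit_cube); last first.
  by apply/seteqP; split=> x /= h j; have := h j; rewrite /= in_itv.
move=> ->; rewrite big1// => j _.
by rewrite /uniform_prob integral_uniform_pdf1.
Qed.

Lemma cube_kernel_out k x u : ~ unit_cube u -> cube_kernel k x u = 0.
Proof.
move=> /existsNP[j /negP uj]; rewrite /cube_kernel big1// => ks _.
by rewrite (bigD1 j)//= window_out ?mul0r ?mulr0.
Qed.

Lemma lipschitz_on_cube_bound (m : d.-tuple R -> R) : lipschitz_on_cube m ->
  exists L : R, [/\ 0 <= L,
    forall u x, unit_cube u -> unit_cube x ->
      `|m u - m x| <= L * \sum_(j < d) `|tnth u j - tnth x j|,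
    forall u x, unit_cube u -> unit_cube x -> `|m u - m x| <= L * d%:R &
    exists M, forall x, unit_cube x -> m x ^+ 2 <= M].
Proof.
move=> [L mL]; have H u x : unit_cube u -> unit_cube x ->
      `|m u - m x| <= `|L| * \sum_(j < d) `|tnth u j - tnth x j|.
  move=> u01 x01; rewrite (le_trans (mL _ _ u01 x01))// ler_wpM2r ?ler_norm//.
  by rewrite sumr_ge0.
have H2 u x : unit_cube u -> unit_cube x -> `|m u - m x| <= `|L| * d%:R.
  move=> u01 x01; rewrite (le_trans (H _ _ u01 x01))// ler_wpM2l//.
  rewrite -[leRHS]mulr1 -[d in leRHS]card_ord -sumr_const mulr_suml ler_sum//
    => j _.
  by rewrite mul1r; have /andP[] := absdiff_itv (x01 j) (u01 j).
exists `|L|; split => //.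
pose o : d.-tuple R := [tuple 0 | j < d].
have o01 : unit_cube o by move=> j; rewrite tnth_mktuple lexx ler01.
exists ((`|m o| + `|L| * d%:R) ^+ 2) => x x01.
rewrite -(real_normK (num_real (m x))) ler_sqr ?nnegrE ?addr_ge0 ?mulr_ge0//.
by have := ler_normD (m x - m o) (m o); rewrite subrK; have := H2 _ _ x01 o01;
  lra.
Qed.

End cube_facts.

(** * Mean squared error at a fixed depth *)

Section mean_squared_error.
Context {R : realType} {d : nat} (d_gt0 : (0 < d)%N)
  {disp : measure_display} {T : measurableType disp} (P : probability T R)
  (m : d.-tuple R -> R) (L M : R) (L_ge0 : 0 <= L)
  (m_lip : forall u x, unit_cube u -> unit_cube x ->
    `|m u - m x| <= L * \sum_(j < d) `|tnth u j - tnth x j|)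
  (m_osc : forall u x, unit_cube u -> unit_cube x -> `|m u - m x| <= L * d%:R)
  (m_bound : forall x, unit_cube x -> m x ^+ 2 <= M)
  (X : {RV P >-> d.-tuple R}) (X_uniform : has_law X (cube_uniform d))
  (eps : {RV P >-> R}) (eps_X_independent : independent_pair eps X)
  (eps_sqr : P.-integrable setT (fun w => (eps w ^+ 2)%:E))
  (eps_mean0 : \int[P]_w eps w = 0)
  (c : R) (c_gt0 : 0 < c)
  (eps_exp : P.-integrable setT (fun w => (expR (c * eps w ^+ 2))%:E))
  (Y : {RV P >-> R}) (Y_def : forall w, Y w = m (X w) + eps w)
  (XY : nat -> {RV P >-> (d.-tuple R * R)%type})
  (XY_copies : forall i, identically_distributed P (XY i) (pair_rv X Y))
  (XY_independent : mutually_independent XY).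

Implicit Types (x u : d.-tuple R) (k : nat).

Let B := L * d%:R.
Let v := \int[P]_w (eps w ^+ 2).
Let mean_kernel k x := \int[P]_w cube_kernel k x (X w).

Let B_ge0 : 0 <= B. Proof. by rewrite mulr_ge0. Qed.

Let v_ge0 : 0 <= v.
Proof. by apply: Rintegral_ge0 => w _; exact: sqr_ge0. Qed.

Let eps_integrable : P.-integrable setT (fun w => (eps w)%:E).
Proof. exact: integrable_of_sqr. Qed.

Let measurable_kernel_X k x :
  measurable_fun setT (fun w => cube_kernel k x (X w)).
Proof. by apply: measurableT_comp => //; exact: measurable_cube_kernel. Qed.

Let kernel01 k x u : unit_cube x -> 0 <= cube_kernel k x u <= 1.
Proof. by move=> x01; rewrite cube_kernel_ge0// cube_kernel_le1. Qed.

Lemma integral_cube_law (g : d.-tuple R -> \bar R) :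
  measurable_fun setT g -> (forall u, 0 <= g u)%E ->
  (\int[P]_w g (X w) = \int[cube_uniform d]_u g u)%E.
Proof.
move=> mg g0; have /= <- := ge0_integral_distribution X mg g0.
by apply: eq_measure_integral => A mA _; exact: (X_uniform mA).
Qed.

Lemma kernel_integrable k x : unit_cube x ->
  P.-integrable setT (fun w => (cube_kernel k x (X w))%:E).
Proof.
move=> x01; apply: (@le_integrable _ _ _ P _ measurableT _ (EFin \o cst 1)).
- exact/measurable_EFinP.
- move=> w _; rewrite /= lee_fin normr1;
  have /andP[k0 k1] := kernel01 k (X w) x01.
  by rewrite ger0_norm.
- exact: finite_measure_integrable_cst.
Qed.

Lemma mean_kernel_ge k x : unit_cube x -> 2^-1 ^+ k <= mean_kernel k x.
Proof.
move=> x01; rewrite -lee_fin -integral_EFin_Rintegral;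
  last exact: kernel_integrable.
rewrite (integral_cube_law (g := fun u => (cube_kernel k x u)%:E)).
- exact: integral_cube_kernel_ge.
- by apply/measurable_EFinP; exact: measurable_cube_kernel.
- by move=> u; rewrite lee_fin cube_kernel_ge0.
Qed.

Lemma mean_kernel_gt0 k x : unit_cube x -> 0 < mean_kernel k x.
Proof.
by move=> x01; rewrite (lt_le_trans _ (mean_kernel_ge k x01))// exprn_gt0//
  invr_gt0.
Qed.

Let residual x (z : d.-tuple R * R) := z.2 - m x.

(** Carrying the kernel, which vanishes outside the cube, allows bounds that
    hold everywhere although m is controlled only on the cube. *)
Let weighted_residual k x (z : d.-tuple R * R) :=
  residual x z * cube_kernel k x z.1.

Let measurable_residual x : measurable_fun setT (residual x).
Proof. by apply: measurable_funB => //; exact: measurable_snd. Qed.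

Let measurable_kernel1 k x :
  measurable_fun setT (fun z : d.-tuple R * R => cube_kernel k x z.1).
Proof.
by apply: (measurableT_comp (measurable_cube_kernel k x));
  exact: measurable_fst.
Qed.

Let measurable_weighted_residual k x :
  measurable_fun setT (weighted_residual k x).
Proof.
apply: measurable_funM; first exact: measurable_residual.
exact: measurable_kernel1.
Qed.

Let residualE x w : residual x (X w, Y w) = (m (X w) - m x) + eps w.
Proof. by rewrite /residual /= Y_def addrAC. Qed.

Let residual_sqr_le x u e : unit_cube x -> unit_cube u ->
  (m u - m x + e) ^+ 2 <= 2 * B ^+ 2 + 2 * e ^+ 2.
Proof.
move=> x01 u01; have := m_osc u01 x01.
rewrite -/B ler_norml => /andP[h1 h2].
have := sqr_ge0 (m u - m x - e).
have : (m u - m x) ^+ 2 <= B ^+ 2.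
  by rewrite -(real_normK (num_real (m u - m x))) ler_sqr ?nnegrE// m_osc.
rewrite !expr2; nra.
Qed.

Let eps2_kernel k x : unit_cube x ->
  P.-integrable setT (fun w => (eps w ^+ 2 * cube_kernel k x (X w))%:E) /\
  \int[P]_w (eps w ^+ 2 * cube_kernel k x (X w)) = v * mean_kernel k x.
Proof.
move=> x01; have i : P.-integrable setT (fun w =>
  (eps w ^+ 2 * cube_kernel k x (X w))%:E).
  apply: (le_integrable _ _ _ eps_sqr) => //.
    by apply/measurable_EFinP; apply: measurable_funM => //;
      exact: measurable_funX.
  move=> w _; rewrite /= lee_fin normrM ler_piMr//.
  by have /andP[k0 k1] := kernel01 k (X w) x01; rewrite ger0_norm.
split => //.
rewrite (independent_RintegralM (f := fun e : R => e ^+ 2) (g :=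
  cube_kernel k x) eps_X_independent)//.
- exact: measurable_cube_kernel.
- exact: kernel_integrable.
Qed.

Let eps_kernel k x : unit_cube x ->
  P.-integrable setT (fun w => (eps w * cube_kernel k x (X w))%:E) /\
  \int[P]_w (eps w * cube_kernel k x (X w)) = 0.
Proof.
move=> x01; have i : P.-integrable setT (fun w =>
  (eps w * cube_kernel k x (X w))%:E).
  apply: (le_integrable _ _ _ eps_integrable) => //.
    by apply/measurable_EFinP; apply: measurable_funM.
  move=> w _; rewrite /= lee_fin normrM ler_piMr//.
  by have /andP[k0 k1] := kernel01 k (X w) x01; rewrite ger0_norm.
split => //.
rewrite (independent_RintegralM (f := id) (g :=
  cube_kernel k x) eps_X_independent)//.
- by rewrite eps_mean0 mul0r.
- exact: measurable_cube_kernel.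
- exact: kernel_integrable.
Qed.

Let weighted_residual_sqr_le k x w : unit_cube x ->
  weighted_residual k x (X w, Y w) ^+ 2 <=
  2 * B ^+ 2 * cube_kernel k x (X w) + 2 * (eps w ^+ 2 * cube_kernel k x (X w)).
Proof.
move=> x01; rewrite /weighted_residual residualE/=.
have [u01|u01] := pselect (unit_cube (X w)); last first.
  by rewrite cube_kernel_out// !mulr0 expr0n addr0.
have /andP[k0 k1] := kernel01 k (X w) x01.
have := residual_sqr_le (eps w) x01 u01.
move: (m (X w) - m x + eps w) (cube_kernel _ _ _) k0 k1 => D K K0 K1 H.
rewrite exprMn (_ : _ + _ = (2 * B ^+ 2 + 2 * eps w ^+ 2) * K); last by ring.
rewrite ler_pM ?sqr_ge0// expr2 ler_piMr//.
Qed.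

(** One factor of the kernel is bounded by 1; the other one is kept, since the
    resulting mean_kernel is small. *)
Lemma weighted_residual_sqr k x : unit_cube x ->
  P.-integrable setT (fun w => (weighted_residual k x (X w, Y w) ^+ 2)%:E) /\
  \int[P]_w (weighted_residual k x (X w, Y w) ^+ 2) <=
    2 * (B ^+ 2 + v) * mean_kernel k x.
Proof.
move=> x01; have [ie2 e2] := eps2_kernel k x01.
have iK := kernel_integrable k x01.
have i1 := integrableZl measurableT (2 * B ^+ 2) iK.
have i2 := integrableZl measurableT 2 ie2.
have i12 := integrableD measurableT i1 i2.
have mW : measurable_fun setT (fun w => weighted_residual k x (X w, Y w)).
  exact: (measurableT_comp (measurable_weighted_residual k x)
    (measurable_pair X Y)).
have i : P.-integrable setT (fun w =>
  (weighted_residual k x (X w, Y w) ^+ 2)%:E).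
  apply: (le_integrable _ _ _ i12) => //.
    by apply/measurable_EFinP; exact: measurable_funX.
  move=> w _; rewrite /= lee_fin ger0_norm ?sqr_ge0// (le_trans
    (weighted_residual_sqr_le _ _ x01))//.
  exact: ler_norm.
split => //.
apply: (le_trans (le_Rintegral _ _ i12 _)) => //.
  by move=> w _; exact: weighted_residual_sqr_le.
rewrite RintegralD// !RintegralZl// e2 le_eqVlt; apply/orP; left; apply/eqP.
by rewrite -/(mean_kernel k x); ring.
Qed.

(** The noise is centered and independent of X, so only the bias remains; the
    Lipschitz property reduces it to the first moments of the kernel. *)
Lemma weighted_residual_mean k x : unit_cube x ->
  `|\int[P]_w weighted_residual k x (X w, Y w)| <=
    L * d%:R * 2 ^+ d * (2^-1 * (1 - (3 * d%:R)^-1)) ^+ k.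
Proof.
move=> x01; have [ieK eK] := eps_kernel k x01.
have mW : measurable_fun setT (fun w => weighted_residual k x (X w, Y w)).
  exact: (measurableT_comp (measurable_weighted_residual k x)
    (measurable_pair X Y)).
have iW : P.-integrable setT (fun w => (weighted_residual k x (X w, Y w))%:E).
  by apply: integrable_of_sqr => //; have [] := weighted_residual_sqr k x01.
pose bias w := weighted_residual k x (X w, Y w) - eps w * cube_kernel k x (X w).
have ib : P.-integrable setT (EFin \o bias).
  exact: (integrableB measurableT iW ieK).
have biasE w : bias w = (m (X w) - m x) * cube_kernel k x (X w).
  by rewrite /bias /weighted_residual residualE /=; ring.
have -> : \int[P]_w weighted_residual k x (X w, Y w) = \int[P]_w bias w.
  by rewrite RintegralB// eK subr0.
rewrite (le_trans (le_normr_Rintegral measurableT ib))// -lee_fin.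
rewrite -integral_EFin_Rintegral; last exact: (integrable_norm ib).
pose g u : R := L * \sum_(r < d) (`|tnth u r - tnth x r| * cube_kernel k x u).
have mr r : measurable_fun setT
    (fun u : d.-tuple R => `|tnth u r - tnth x r| * cube_kernel k x u).
  apply: measurable_funM; last exact: measurable_cube_kernel.
  apply: (@measurableT_comp _ _ _ _ _ _ (@Num.norm _ R));
    first exact: normr_measurable.
  by apply: measurable_funB => //; exact: measurable_tnth.
have mg : measurable_fun setT g.
  by apply: measurable_funM => //; exact: measurable_sum.
have r0 r u : 0 <= `|tnth u r - tnth x r| * cube_kernel k x u.
  by rewrite mulr_ge0// cube_kernel_ge0.
have g0 u : 0 <= g u by rewrite mulr_ge0// sumr_ge0.
apply: (@le_trans _ _ (\int[P]_w (g (X w))%:E)%E).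
  apply: ge0_le_integral => //.
  - apply/measurable_EFinP;
    apply: (@measurableT_comp _ _ _ _ _ _ (@Num.norm _ R));
      first exact: normr_measurable.
    by apply/measurable_EFinP; exact: measurable_int ib.
  - by apply/measurable_EFinP; exact: (measurableT_comp mg).
  move=> w _; rewrite lee_fin biasE /g -mulr_suml mulrA normrM.
  have [u01|u01] := pselect (unit_cube (X w)); last first.
    by rewrite cube_kernel_out// normr0 !mulr0.
  have /andP[k0 _] := kernel01 k (X w) x01.
  by rewrite (ger0_norm k0) ler_wpM2r// m_lip.
rewrite (integral_cube_law (g := EFin \o g)); last 2 first.
- exact/measurable_EFinP.
- by move=> u; rewrite lee_fin.
rewrite /g /=; under eq_integral do rewrite EFinM -sumEFin.
rewrite ge0_integralZl//; last 2 first.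
- under eq_fun do rewrite sumEFin.
  by apply/measurable_EFinP; exact: measurable_sum.
- by move=> u _; rewrite sumEFin lee_fin sumr_ge0.
rewrite ge0_integral_sum//; last 2 first.
- by move=> r; exact/measurable_EFinP.
- by move=> r u _; rewrite lee_fin.
rewrite -!mulrA EFinM lee_wpmul2l ?lee_fin//.
set h := 2 ^+ d * _.
apply: (@le_trans _ _ (\sum_(r < d) h%:E)%E).
  by apply: lee_sum => r _; exact: integral_cube_kernel_dist_le.
by rewrite sumEFin lee_fin sumr_const card_ord -(mulr_natl h).
Qed.

(** The kernel takes its values in [0, 1], so its variance is at most its
    mean. *)
Lemma kernel_deviation_sqr k x : unit_cube x ->
  P.-integrable setT (fun w =>
    ((cube_kernel k x (X w) - mean_kernel k x) ^+ 2)%:E) /\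
  \int[P]_w ((cube_kernel k x (X w) - mean_kernel k x) ^+ 2) <= mean_kernel k x.
Proof.
move=> x01; have mu0 := ltW (mean_kernel_gt0 k x01).
have iK := kernel_integrable k x01.
have mu1 : mean_kernel k x <= 1.
  have := @le_Rintegral _ _ _ P setT (fun w =>
    cube_kernel k x (X w)) (cst 1) measurableT iK.
  rewrite Rintegral_probability_cst.
  apply; first exact: finite_measure_integrable_cst.
  by move=> w _; have /andP[] := kernel01 k (X w) x01.
have dev w : (cube_kernel k x (X w) - mean_kernel k x) ^+ 2 <=
    (1 - 2 * mean_kernel k x) * cube_kernel k x (X w) + mean_kernel k x ^+ 2.
  have /andP[] := kernel01 k (X w) x01; rewrite !expr2; nra.
have dev1 w : (cube_kernel k x (X w) - mean_kernel k x) ^+ 2 <= 1.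
  have /andP[k0 k1] := kernel01 k (X w) x01.
  have h1 : 0 <= 1 - (cube_kernel k x (X w) - mean_kernel k x) by lra.
  have h2 : 0 <= 1 + (cube_kernel k x (X w) - mean_kernel k x) by lra.
  by rewrite -subr_ge0 -[X in 0 <= X - _](expr1n _ 2) subr_sqr mulr_ge0.
have md : measurable_fun setT
    (fun w => (cube_kernel k x (X w) - mean_kernel k x) ^+ 2).
  by apply: measurable_funX; exact: measurable_funB.
have i1 := finite_measure_integrable_cst P (1 : R) measurableT.
have i : P.-integrable setT (fun w =>
  ((cube_kernel k x (X w) - mean_kernel k x) ^+ 2)%:E).
  apply: (@le_integrable _ _ _ P _ measurableT _ (EFin \o cst 1)).
  - exact/measurable_EFinP.
  - by move=> w _; rewrite /= lee_fin normr1 ger0_norm ?sqr_ge0.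
  - exact: i1.
split => //.
have i2 := integrableZl measurableT (1 - 2 * mean_kernel k x) iK.
have i3 := finite_measure_integrable_cst P (mean_kernel k x ^+ 2) measurableT.
have i23 := integrableD measurableT i2 i3.
apply: (le_trans (le_Rintegral _ _ i23 _)) => //.
rewrite RintegralD// RintegralZl// Rintegral_probability_cst.
rewrite -/(mean_kernel k x) expr2; nra.
Qed.

(** The indicator restricts the exponential to the points where m u - m x is
    bounded. *)
Let exp_residual x (z : d.-tuple R * R) :=
  \1_(@unit_cube R d) z.1 * expR (c / 2 * residual x z ^+ 2).

Let measurable_exp_residual x : measurable_fun setT (exp_residual x).
Proof.
apply: measurable_funM.
  apply: (@measurableT_comp _ _ _ _ _ _ (\1_(@unit_cube R d) : d.-tuple R ->
    R)).
    exact: measurable_indic measurable_unit_cube.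
  exact: measurable_fst.
apply: measurableT_comp => //; apply: measurable_funM => //.
by apply: measurable_funX; exact: measurable_residual.
Qed.

Let exp_residual_ge0 x z : 0 <= exp_residual x z.
Proof. by rewrite mulr_ge0 ?expR_ge0// indicE ler0n. Qed.

Lemma exp_residual_mean x : unit_cube x ->
  (\int[P]_w (exp_residual x (X w, Y w))%:E <=
   (expR (c * B ^+ 2) * \int[P]_w expR (c * eps w ^+ 2))%:E)%E.
Proof.
move=> x01; rewrite EFinM -integral_EFin_Rintegral//.
have me : measurable_fun setT (fun w => (expR (c * eps w ^+ 2))%:E) :=
  measurable_int _ eps_exp.
rewrite -ge0_integralZl//.
apply: ge0_le_integral => //.
- by move=> w _; rewrite lee_fin.
- apply/measurable_EFinP.
  exact: (measurableT_comp (measurable_exp_residual x) (measurable_pair X Y)).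
- by apply: emeasurable_funM.
move=> w _; rewrite -EFinM lee_fin /exp_residual indicE.
have [u01|u01] := pselect (unit_cube (X w)); last first.
  by rewrite memNset//= mul0r mulr_ge0 ?expR_ge0.
rewrite mem_set//= mul1r -expRD ler_expR residualE.
have := residual_sqr_le (eps w) x01 u01; have := c_gt0; nra.
Qed.

(** Each data point is in the cube almost surely, and there are countably
    many of them. *)
Lemma data_in_cube : {ae P, forall w, forall i, unit_cube (XY i w).1}.
Proof.
have H (i : nat) : {ae P, forall w, unit_cube (XY i w).1}.
  have mC : measurable (~` (@unit_cube R d)) by apply: measurableC;
    exact: (@measurable_unit_cube R d).
  have mA : measurable (@fst (d.-tuple R) R @^-1` (~` @unit_cube R d)).
    by rewrite -[X in measurable X]setTI; exact: measurable_fst.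
  exists (XY i @^-1` (@fst (d.-tuple R) R @^-1` (~` @unit_cube R d))); split.
  - by rewrite -[X in measurable X]setTI; exact: measurable_funPT.
  - have -> := XY_copies i mA.
    have := X_uniform mC; rewrite /distribution /pushforward /= => ->.
    rewrite probability_setC; last exact: (@measurable_unit_cube R d).
    by rewrite (@cube_uniform_unit_cube R d) subee.
  - move=> w /=; exact.
exact: (ae_foralln H).
Qed.

(** Expectation of weighted_average_error with N = n * mean_kernel k x. The two
    terms with 2 ^+ k / n come from the variances of the sums, the one with
    (1 - 1 / (3 d)) ^+ k from the mean of the weighted residuals, and the last
    one from the part of the largest squared residual above the level t. *)
Lemma kerf_mean_squared_error_le k n x t :
  (0 < n)%N -> unit_cube x -> 0 <= t ->
  ('E_P[fun w => ((uniform_kerf k n (fun i => XY i w) x - m x) ^+ 2)%R] <=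
   (8 * (B ^+ 2 + v) * (2 ^+ k / n%:R) +
    4 * (B * 2 ^+ d) ^+ 2 * ((1 - (3 * d%:R)^-1) ^+ k) ^+ 2 +
    4 * (M + t) * (2 ^+ k / n%:R) +
    (c / 2)^-1 * (expR (c * B ^+ 2) * \int[P]_w expR (c * eps w ^+ 2)) *
      (n%:R * expR (- (c / 2 * t))))%:E)%E.
Proof.
move=> n0 x01 t0; rewrite unlock.
set mu := mean_kernel k x; pose N := n%:R * mu.
have mu0 : 0 < mu := mean_kernel_gt0 k x01.
have mu2 : 2^-1 ^+ k <= mu := mean_kernel_ge k x01.
have nR0 : 0 < n%:R :> R by rewrite ltr0n.
have N0 : 0 < N by rewrite mulr_gt0.
have c20 : 0 < c / 2 by rewrite divr_gt0.
have M0 : 0 <= M by rewrite (le_trans _ (m_bound x01))// sqr_ge0.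
pose A w := (\sum_(i < n) weighted_residual k x (XY i w)) ^+ 2.
pose S w := (\sum_(i < n) (cube_kernel k x (XY i w).1 - mu)) ^+ 2.
pose E w := \sum_(i < n) exp_residual x (XY i w).
pose a := 4 / N ^+ 2; pose b := 4 * (M + t) / N ^+ 2.
pose g := (c / 2)^-1 * expR (- (c / 2 * t)).
have a0 : 0 <= a by rewrite divr_ge0// exprn_ge0// ltW.
have b0 : 0 <= b.
  by rewrite divr_ge0 ?exprn_ge0 ?(ltW N0)// mulr_ge0// addr_ge0.
have g0 : 0 <= g by rewrite mulr_ge0 ?expR_ge0// invr_ge0 ltW.
have mXY (f : d.-tuple R * R -> R) i : measurable_fun setT f ->
  measurable_fun setT (fun w => f (XY i w)).
  by move=> mf; exact: (measurableT_comp mf).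
have mA : measurable_fun setT A.
  apply: measurable_funX; apply: measurable_sum => i.
  exact: mXY (measurable_weighted_residual k x).
have mS : measurable_fun setT S.
  apply: measurable_funX; apply: measurable_sum => i;
    apply: measurable_funB => //.
  exact: (mXY _ _ (measurable_kernel1 k x)).
have mE : measurable_fun setT E.
  by apply: measurable_sum => i; exact: mXY (measurable_exp_residual x).
have A0 w : 0 <= A w by exact: sqr_ge0.
have S0 w : 0 <= S w by exact: sqr_ge0.
have E0 w : 0 <= E w by exact: sumr_ge0.
have mkerf :
    measurable_fun setT (fun w => uniform_kerf k n (fun i => XY i w) x).
  rewrite /uniform_kerf; apply: measurable_funM; last first.
    apply: (measurableT_comp (@measurable_invr R)); apply: measurable_sum => i.
    apply: (mXY (fun z => uniform_kernel k (absdiff z.1 x))).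
    by apply: (measurableT_comp (measurable_uniform_kernel k x));
      exact: measurable_fst.
  apply: measurable_sum => i.
  apply: (mXY (fun z => z.2 * uniform_kernel k (absdiff z.1 x))).
  apply: measurable_funM; first exact: measurable_snd.
  by apply: (measurableT_comp (measurable_uniform_kernel k x));
    exact: measurable_fst.
have le1 : (\int[P]_w ((uniform_kerf k n (fun i => XY i w) x - m x) ^+ 2)%:E <=
    \int[P]_w ((a%:E * (A w)%:E + b%:E * (S w)%:E) + g%:E * (E w)%:E))%E.
  apply: ae_ge0_le_integral => //.
  - by move=> w _; rewrite lee_fin sqr_ge0.
  - by apply/measurable_EFinP; apply: measurable_funX; exact: measurable_funB.
  - by move=> w _; rewrite -!EFinM -!EFinD lee_fin !addr_ge0// mulr_ge0.
  - apply/measurable_EFinP; apply: measurable_funD.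
      by apply: measurable_funD; apply: measurable_funM.
    by apply: measurable_funM.
  apply: filterS data_in_cube => w XYw _.
  rewrite -!EFinM -!EFinD lee_fin /uniform_kerf.
  have Kw (i : 'I_n) : uniform_kernel k (absdiff (XY i w).1 x) =
      cube_kernel k x (XY i w).1.
    by rewrite cube_kernelE.
  under eq_bigr do rewrite Kw.
  under [X in _ / X]eq_bigr do rewrite Kw.
  have /= := weighted_average_error (fun i : 'I_n => (XY i w).2)
    (fun i => cube_kernel_ge0 k (XY i w).1 x01) N0 c20 t0 (m_bound x01).
  move=> /le_trans; apply; rewrite lerD//; last first.
    rewrite /g -[leRHS]mulrA ler_wpM2l ?invr_ge0 ?(ltW c20)// mulr_sumr
      ler_sum// => i _.
    rewrite /exp_residual indicE mem_set ?mul1r//.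
    by rewrite -expRD mulrBr addrC.
  rewrite lerD// /S /N; rewrite [leLHS](_ : _ = b * S w)//; congr (_ * _ ^+ 2).
  by rewrite sumrB sumr_const card_ord -(mulr_natl mu).
have h0 : 0 <= 1 - (3 * d%:R)^-1 :> R.
  by rewrite subr_ge0 invf_le1 ?mulr_gt0 ?ltr0n// -natrM ler1n muln_gt0.
have intA : (\int[P]_w (A w)%:E <=
    (n%:R * (2 * (B ^+ 2 + v) * mu) +
     (n%:R * (B * 2 ^+ d * (2^-1 * (1 - (3 * d%:R)^-1)) ^+ k)) ^+ 2)%:E)%E.
  have [i2 l2] := weighted_residual_sqr k x01.
  apply: (le_trans (second_moment_sum (Z' := pair_rv X Y) n XY_independent
    XY_copies (measurable_weighted_residual k x) i2)).
  rewrite lee_fin lerD// ?ler_pM2l//.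
  rewrite -(real_normK (num_real (n%:R * _))) ler_sqr ?nnegrE ?normr_ge0//;
    last first.
    by rewrite !mulr_ge0 ?exprn_ge0 ?mulr_ge0 ?invr_ge0.
  by rewrite normrM normr_nat ler_pM2l// weighted_residual_mean.
have intS : (\int[P]_w (S w)%:E <= (n%:R * mu)%:E)%E.
  have [i2 l2] := kernel_deviation_sqr k x01.
  have mK : measurable_fun setT (fun z : d.-tuple R * R =>
    cube_kernel k x z.1 - mu).
    by apply: measurable_funB => //; exact: measurable_kernel1.
  apply: (le_trans (second_moment_sum (Z' :=
    pair_rv X Y) n XY_independent XY_copies mK i2)).
  rewrite lee_fin [X in _ + (_ * X) ^+ 2](_ : _ = 0) ?mulr0 ?expr0n ?addr0
    ?ler_pM2l//.
  rewrite RintegralB//; last 2 first.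
    exact: kernel_integrable.
    exact: finite_measure_integrable_cst.
  by rewrite (Rintegral_probability_cst P mu) subrr.
have intE : (\int[P]_w (E w)%:E <=
    (n%:R * (expR (c * B ^+ 2) * \int[P]_w expR (c * eps w ^+ 2)))%:E)%E.
  rewrite /E; under eq_integral do rewrite -sumEFin.
  rewrite ge0_integral_sum//; last 2 first.
  - by move=> i; apply/measurable_EFinP;
    exact: (mXY _ _ (measurable_exp_residual x)).
  - by move=> i w _; rewrite lee_fin.
  rewrite (eq_bigr (fun=> \int[P]_w (exp_residual x (X w, Y w))%:E)%E);
    last first.
    move=> i _; apply: (identically_distributed_ge0_integral (Z' := pair_rv X Y)
      (g := EFin \o exp_residual x)) => //.
      exact/measurable_EFinP.
    by move=> z; rewrite lee_fin.
  apply: (@le_trans _ _ (\sum_(i < n) (expR (c * B ^+ 2) *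
      \int[P]_w expR (c * eps w ^+ 2))%:E)%E).
    by apply: lee_sum => i _; exact: exp_residual_mean.
  by rewrite sumEFin lee_fin sumr_const card_ord -(mulr_natl (_ * _)).
apply: (le_trans le1).
have EA : measurable_fun setT (EFin \o A) by exact/measurable_EFinP.
have ES : measurable_fun setT (EFin \o S) by exact/measurable_EFinP.
have EE : measurable_fun setT (EFin \o E) by exact/measurable_EFinP.
rewrite ge0_integralD//; last 4 first.
- by move=> w _; rewrite -!EFinM -!EFinD lee_fin addr_ge0// mulr_ge0.
- by apply: emeasurable_funD; apply: emeasurable_funM.
- by move=> w _; rewrite -EFinM lee_fin mulr_ge0.
- by apply: emeasurable_funM.
rewrite ge0_integralD//; last 4 first.
- by move=> w _; rewrite -EFinM lee_fin mulr_ge0.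
- by apply: emeasurable_funM.
- by move=> w _; rewrite -EFinM lee_fin mulr_ge0.
- by apply: emeasurable_funM.
rewrite !ge0_integralZl//.
2-4: by move=> w _; rewrite lee_fin.
set IA := (\int[P]_w (A w)%:E)%E in intA *.
set IS := (\int[P]_w (S w)%:E)%E in intS *.
set IE := (\int[P]_w (E w)%:E)%E in intE *.
have := leeD (leeD (lee_wpmul2l (_ : 0 <= a%:E)%E intA)
  (lee_wpmul2l (_ : 0 <= b%:E)%E intS)) (lee_wpmul2l (_ : 0 <= g%:E)%E intE).
rewrite !lee_fin => /(_ a0 b0 g0) /le_trans; apply.
rewrite -!EFinM -!EFinD lee_fin.
have mun0 : mu != 0 by rewrite gt_eqF.
have nn0 : n%:R != 0 :> R by rewrite gt_eqF.
have muV : mu^-1 <= 2 ^+ k.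
  by rewrite -[leRHS]invrK lef_pV2 ?posrE ?invr_gt0 ?exprn_gt0// -exprVn.
have muVn : mu^-1 / n%:R <= 2 ^+ k / n%:R by rewrite ler_pM2r ?invr_gt0.
set h := 1 - (3 * d%:R)^-1.
set Cw := expR (c * B ^+ 2) * _.
have -> : a * (n%:R * (2 * (B ^+ 2 + v) * mu) +
      (n%:R * (B * 2 ^+ d * (2^-1 * h) ^+ k)) ^+ 2) + b * (n%:R * mu) +
      g * (n%:R * Cw) =
    8 * (B ^+ 2 + v) * (mu^-1 / n%:R) +
    4 * (B * 2 ^+ d) ^+ 2 * (h ^+ k) ^+ 2 * (2^-1 ^+ k / mu) ^+ 2 +
    4 * (M + t) * (mu^-1 / n%:R) + g * (n%:R * Cw).
  congr (_ + _); rewrite /a /b /N [(2^-1 * h) ^+ k]exprMn.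
  move: (h ^+ k) (2^-1 ^+ k) (2 ^+ d) => p q r.
  by field; rewrite mun0 nn0.
rewrite !lerD//.
- by rewrite ler_wpM2l// mulr_ge0// addr_ge0// sqr_ge0.
- rewrite ler_piMr ?mulr_ge0 ?sqr_ge0 ?exprn_ge0//.
  by rewrite expr_le1// ?divr_ge0 ?exprn_ge0 ?invr_ge0 ?(ltW mu0)//
    ler_pdivrMr// mul1r.
- by rewrite ler_wpM2l// mulr_ge0// addr_ge0.
- by rewrite /g le_eqVlt; apply/orP; left; apply/eqP; ring.
Qed.

End mean_squared_error.

(** * Choice of the depth *)

Section depth.
Context {R : realType}.
Implicit Types (d n : nat).

(** The squared bias at depth k is at most exp (- k * bias_rate d) up to a
    constant, because (1 - 1 / (3 d)) ^ 2 <= exp (- 2 / (3 d)). *)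
Definition bias_rate d : R := 2 / (3 * d%:R).

(** The variance 2 ^ k / n and the squared bias exp (- k * bias_rate d) balance
    when k is ln n / (ln 2 + bias_rate d). *)
Definition depth d n : nat := Num.truncn (ln n%:R / (ln 2 + bias_rate d)).

Let ln2_gt0 : 0 < ln 2 :> R. Proof. by rewrite ln_gt0// ltr1n. Qed.

Lemma bias_rate_gt0 d : (0 < d)%N -> 0 < bias_rate d.
Proof. by move=> d0; rewrite divr_gt0// mulr_gt0// ltr0n. Qed.

Lemma depth_cvgy d : (0 < d)%N -> depth d n @[n --> \oo] --> \oo.
Proof.
move=> d0; apply/cvgnyPgt => A.
have b0 : 0 < ln 2 + bias_rate d by rewrite addr_gt0// bias_rate_gt0.
near=> n; rewrite /depth truncn_gt_nat ler_pdivlMr//.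
rewrite -[leLHS]expRK ler_ln ?posrE ?expR_gt0//.
  by near: n; exact: nbhs_infty_ger.
by rewrite (lt_le_trans (expR_gt0 (A.+1%:R * (ln 2 + bias_rate d))))//;
  near: n; exact: nbhs_infty_ger.
Unshelve. all: by end_near. Qed.

(** The exponent of the theorem is bias_rate d / (ln 2 + bias_rate d), since
    bias_rate d * (3 / 2 * d) = 1. *)
Lemma rate_exponentE d : (0 < d)%N ->
  1 / (1 + 3 / 2 * d%:R * ln 2) = bias_rate d / (ln 2 + bias_rate d).
Proof.
move=> d0; have dR : 0 < d%:R :> R by rewrite ltr0n.
rewrite /bias_rate; field.
rewrite !gt_eqF// ?addr_gt0 ?mulr_gt0 ?divr_gt0//.
Qed.

Lemma rate_expR d n : (0 < d)%N -> (0 < n)%N ->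
  n%:R `^ (- (1 / (1 + 3 / 2 * d%:R * ln 2))) =
  expR (- (bias_rate d / (ln 2 + bias_rate d) * ln n%:R)) :> R.
Proof.
by move=> d0 n0; rewrite /powR pnatr_eq0 gtn_eqF// rate_exponentE// mulNr.
Qed.

Lemma depth_variance_le d n : (0 < d)%N -> (0 < n)%N ->
  2 ^+ depth d n / n%:R <= n%:R `^ (- (1 / (1 + 3 / 2 * d%:R * ln 2))) :> R.
Proof.
move=> d0 n0; have nR : 0 < n%:R :> R by rewrite ltr0n.
have b0 : 0 < ln 2 + bias_rate d by rewrite addr_gt0// bias_rate_gt0.
have l0 : 0 <= ln n%:R :> R by rewrite ln_ge0// ler1n.
rewrite rate_expR// -[X in X ^+ _](@lnK R 2) ?posrE// -expRM_natl.
rewrite -[X in _ / X](@lnK R n%:R) ?posrE// -expRB ler_expR.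
have : (depth d n)%:R <= ln n%:R / (ln 2 + bias_rate d).
  by have /andP[] := truncn_itv (divr_ge0 l0 (ltW b0)).
rewrite -(ler_pM2r ln2_gt0).
have -> : ln n%:R / (ln 2 + bias_rate d) * ln 2 =
    ln n%:R - bias_rate d / (ln 2 + bias_rate d) * ln n%:R.
  by field; rewrite gt_eqF.
lra.
Qed.

(** The factor exp (bias_rate d) pays for rounding the depth down. *)
Lemma depth_bias_le d n : (0 < d)%N -> (0 < n)%N ->
  ((1 - (3 * d%:R)^-1) ^+ depth d n) ^+ 2 <=
  expR (bias_rate d) * n%:R `^ (- (1 / (1 + 3 / 2 * d%:R * ln 2))) :> R.
Proof.
move=> d0 n0; have nR : 0 < n%:R :> R by rewrite ltr0n.
have dR : 0 < d%:R :> R by rewrite ltr0n.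
have b0 : 0 < ln 2 + bias_rate d by rewrite addr_gt0// bias_rate_gt0.
have l0 : 0 <= ln n%:R :> R by rewrite ln_ge0// ler1n.
have h0 : 0 <= 1 - (3 * d%:R)^-1 :> R.
  by rewrite subr_ge0 invf_le1 ?mulr_gt0// -natrM ler1n muln_gt0.
rewrite rate_expR// -expRD -exprM.
apply: (@le_trans _ _ (expR (- (3 * d%:R)^-1) ^+ (depth d n * 2))).
  rewrite lerXn2r ?nnegrE ?expR_ge0//; exact: expR_ge1Dx.
rewrite -expRM_natl ler_expR natrM.
have : ln n%:R / (ln 2 + bias_rate d) < (depth d n).+1%:R.
  by have /andP[] := truncn_itv (divr_ge0 l0 (ltW b0)).
rewrite -(ltr_pM2r (bias_rate_gt0 d0)) -natr1 => H.
have -> : (depth d n)%:R * 2 * - (3 * d%:R)^-1 = - ((depth d n)%:R * bias_rate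
  d).
  by rewrite /bias_rate; field; rewrite gt_eqF.
have E : ln n%:R / (ln 2 + bias_rate d) * bias_rate d =
   bias_rate d / (ln 2 + bias_rate d) * ln n%:R by ring.
rewrite E in H; lra.
Qed.

Lemma rate_ge_inv d n : (0 < d)%N -> (0 < n)%N ->
  n%:R^-1 <= n%:R `^ (- (1 / (1 + 3 / 2 * d%:R * ln 2))) :> R.
Proof.
move=> d0 n0; have nR : 0 < n%:R :> R by rewrite ltr0n.
have b0 : 0 < ln 2 + bias_rate d by rewrite addr_gt0// bias_rate_gt0.
have l0 : 0 <= ln n%:R :> R by rewrite ln_ge0// ler1n.
rewrite rate_expR// -[X in X^-1](@lnK R n%:R) ?posrE// -expRN ler_expR lerN2.
by rewrite ler_piMl// ler_pdivrMr// mul1r lerDr ltW.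
Qed.

End depth.

Theorem theorem2 (R : realType) (d : nat) (d_ge1 : (1 <= d)%N)
    (disp : measure_display) (T : measurableType disp) (P : probability T R)
    (m : d.-tuple R -> R) (m_lipschitz : lipschitz_on_cube m)
    (X : {RV P >-> d.-tuple R}) (X_uniform : has_law X (cube_uniform d))
    (eps : {RV P >-> R}) (s : R) (s_ge0 : 0 <= s)
    (eps_gaussian : has_law eps (centered_gaussian s))
    (eps_X_independent : independent_pair eps X)
    (Y : {RV P >-> R}) (Y_def : forall w, Y w = m (X w) + eps w)
    (XY : nat -> {RV P >-> (d.-tuple R * R)%type})
    (XY_copies : forall i,
       identically_distributed P (XY i) (fun w => (X w, Y w)))
    (XY_independent : mutually_independent XY) :
  exists (k : nat -> nat) (C : R),
    k n @[n --> \oo] --> \oo /\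
    forall (n : nat) (x : d.-tuple R), (1 < n)%N -> unit_cube x ->
      ('E_P[fun w => ((uniform_kerf (k n) n (fun i => XY i w) x - m x) ^+ 2)%R]
       <= (C * n%:R `^ (- (1 / (1 + 3 / 2 * d%:R * ln 2))) * ln n%:R)%:E)%E.
Proof.
have [L [L0 mL mB [M mM]]] := lipschitz_on_cube_bound m_lipschitz.
have [c c0 eps_exp] := gaussian_exp_sqr_integrable eps_gaussian.
have eps_sqr := gaussian_sqr_integrable eps_gaussian.
have eps_mean0 := gaussian_mean0 eps_gaussian.
pose v := \int[P]_w (eps w ^+ 2).
pose B := L * d%:R.
pose Cw := expR (c * B ^+ 2) * \int[P]_w expR (c * eps w ^+ 2).
pose C0 := 8 * (B ^+ 2 + v) + 4 * (B * 2 ^+ d) ^+ 2 * expR (bias_rate d) +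
  4 * M + (c / 2)^-1 * Cw.
exists (@depth R d), (C0 / ln 2 + 16 / c); split; first exact: depth_cvgy.
move=> n x n1 x01; have n0 : (0 < n)%N by exact: ltnW.
have nR : 0 < n%:R :> R by rewrite ltr0n.
have ln2 : 0 < ln 2 :> R by rewrite ln_gt0// ltr1n.
have lnn : ln 2 <= ln n%:R :> R by rewrite ler_ln ?posrE// ler_nat.
(* at the level t = 4 * ln n / c,
  n exponentials of - c / 2 * t add up to 1 / n *)
have t0 : 0 <= 4 * ln n%:R / c by rewrite divr_ge0 ?mulr_ge0 ?(ltW c0)//
  (le_trans (ltW ln2)).
apply: (le_trans (kerf_mean_squared_error_le d_ge1 L0 mL mB mM X_uniform
  eps_X_independent eps_sqr eps_mean0 c0 eps_exp Y_def XY_copies XY_independent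
  (depth d n) n0 x01 t0)).
rewrite lee_fin -/v -/B -/Cw.
set rho := _ `^ _.
have V : 2 ^+ depth d n / n%:R <= rho := depth_variance_le d_ge1 n0.
have Bi : ((1 - (3 * d%:R)^-1) ^+ depth d n) ^+ 2 <= expR (bias_rate d) * rho :=
  depth_bias_le d_ge1 n0.
have I : n%:R * expR (- (c / 2 * (4 * ln n%:R / c))) <= rho.
  rewrite (_ : - _ = - (2%:R * ln n%:R)); last by field; rewrite gt_eqF.
  rewrite expRN expRM_natl lnK ?posrE// expr2 invfM mulrA divff ?gt_eqF// mul1r.
  exact: rate_ge_inv.
have rho0 : 0 <= rho by exact: powR_ge0.
have v0 : 0 <= v by apply: Rintegral_ge0 => w _; exact: sqr_ge0.
have M0 : 0 <= M by rewrite (le_trans _ (mM _ x01))// sqr_ge0.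
have Cw0 : 0 <= Cw.
  by rewrite mulr_ge0 ?expR_ge0//; apply: Rintegral_ge0 => w _; exact: expR_ge0.
have c2 : 0 <= (c / 2)^-1 by rewrite invr_ge0 divr_ge0// ltW.
have C00 : 0 <= C0.
  have q1 : 0 <= 8 * (B ^+ 2 + v) by rewrite mulr_ge0// addr_ge0// sqr_ge0.
  have q2 : 0 <= 4 * (B * 2 ^+ d) ^+ 2 * expR (bias_rate d).
    by apply: mulr_ge0; [rewrite mulr_ge0// sqr_ge0|exact: expR_ge0].
  have q3 : 0 <= 4 * M by exact: mulr_ge0.
  have q4 : 0 <= (c / 2)^-1 * Cw by exact: mulr_ge0.
  exact: (addr_ge0 (addr_ge0 (addr_ge0 q1 q2) q3) q4).
apply: (@le_trans _ _ ((C0 + 16 / c * ln n%:R) * rho)); last first.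
  rewrite [leRHS]mulrAC; apply: ler_wpM2r => //.
  rewrite [leRHS]mulrDl; apply: lerD => //.
  by rewrite mulrAC ler_pdivlMr// ler_wpM2l.
have -> : (C0 + 16 / c * ln n%:R) * rho =
    8 * (B ^+ 2 + v) * rho + 4 * (B * 2 ^+ d) ^+ 2 * (expR (bias_rate d) * rho)
      +
    4 * (M + 4 * ln n%:R / c) * rho + (c / 2)^-1 * Cw * rho.
  by rewrite /C0; field; rewrite gt_eqF.
rewrite !lerD//.
- by rewrite ler_wpM2l// mulr_ge0// addr_ge0// sqr_ge0.
- by rewrite ler_wpM2l// mulr_ge0// sqr_ge0.
- by rewrite ler_wpM2l// mulr_ge0// addr_ge0.
- by rewrite ler_wpM2l// mulr_ge0.
Qed.
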